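(* Let $(\Omega,\mathcal F,\mu)$ be a complete probability space with $\mu$ non-atomic, let $X$ be a complete separable metric space with Borel $\sigma$-field $\mathcal B(X)$, and let $A$ be a correspondence from $\Omega$ to $X$ with $A(\omega)\neq\emptyset$ for each $\omega\in\Omega$ and with graph $Gr(A)=\{(\omega,x):\omega\in\Omega,\ x\in A(\omega)\}\in\mathcal F\otimes\mathcal B(X)$. Let $g_i:Gr(A)\to\mathbb R$, $i=1,\dots,n$, be $\mathcal F\otimes\mathcal B(X)$-measurable functions, put $g=(g_1,\dots,g_n)$, and let $\varphi\in\Phi$ be a randomized decision function such that $$\int_\Omega\int_{A(\omega)}|g_i(\omega,x)|\,\varphi(\omega)(dx)\,\mu(d\omega)<\infty\quad\text{for all } i=1,\dots,n.$$ Let $\mathcal G$ be a sub-$\sigma$-field of $\mathcal F$ such that $\mathcal F$ has no $\mathcal G$-atoms. Then there exists a non-randomized decision function $f\in F$ such that $$E(I_\varphi(g)\,|\,\mathcal G)=E(I_f(g)\,|\,\mathcal G)\quad \mu\text{-almost everywhere}.$$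
   Context: $P(X)$ is the space of all probability measures on $(X,\mathcal B(X))$ with the topology of weak convergence and its Borel $\sigma$-field. A randomized decision function is a measurable mapping $\varphi:\Omega\to P(X)$ (with respect to $\mathcal F$) such that $\varphi(\omega)(A(\omega))=1$ for all $\omega\in\Omega$; $\Phi$ denotes the set of all of them. A non-randomized (pure) decision function is a measurable mapping $f:\Omega\to X$ such that $f(\omega)\in A(\omega)$ for all $\omega\in\Omega$; $F$ denotes the set of all of them. For $\varphi\in\Phi$ and $f\in F$, put $I_\varphi(g)(\omega):=\int_{A(\omega)}g(\omega,x)\,\varphi(\omega)(dx)\in\mathbb R^n$ (integrated componentwise) and $I_f(g)(\omega):=g(\omega,f(\omega))$ for $\omega\in\Omega$. For a sub-$\sigma$-field $\mathcal G\subset\mathcal F$, a set $D\in\mathcal F$ is called a $\mathcal G$-atom if $\mu(D)>0$ and for any $D_1\in\mathcal F$ there exists $D_2\in\mathcal G$ such that $\mu((D\cap D_1)\triangle(D\cap D_2))=0$. $E(\cdot\,|\,\mathcal G)$ is the conditional expectation with respect to $\mu$ (componentwise for $\mathbb R^n$-valued functions). *)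

(* Defs.v *)
From HB Require Import structures.
From mathcomp Require Import all_boot all_order all_algebra.
From mathcomp Require Import all_classical all_reals all_analysis.
From mathcomp Require Import measurable_realfun.

Set Implicit Arguments.
Unset Strict Implicit.
Unset Printing Implicit Defensive.

Import Order.TTheory GRing.Theory Num.Theory.
Import numFieldTopology.Exports numFieldNormedType.Exports.

Local Open Scope classical_set_scope.
Local Open Scope ring_scope.

(* The library complete pseudometric spaces are pointed, hence nonempty. *)
#[short(type="completeMetricType")]
HB.structure Definition CompleteMetric (R : numDomainType) :=
  {T of CompletePseudoMetric R T & Metric R T}.

Definition separable (T : topologicalType) : Prop :=
  exists2 D : set T, countable D & dense D.

Notation borel T := (g_sigma_algebraType (@open T)).

Section weak_convergence.
Context (R : realType) (X : ptopologicalType).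

Definition bounded_continuous : Type :=
  {h : X -> R | continuous h /\ [bounded h x | x in [set: X]]}.

Definition test_integrals (nu : probability (borel X) R) :
    {ptws bounded_continuous -> R} :=
  fun h => \int[nu]_x sval h x.

(* The coarsest topology on probability measures for which the integral of every
   bounded continuous function is continuous. *)
Definition weak_probability : ptopologicalType :=
  initial_topology test_integrals.

End weak_convergence.

Section sub_sigma_algebras.
Context d (T : measurableType d) (R : realType).
Implicit Types (mu : probability T R) (G : set (set T)) (D : set T).

Definition nonatomic mu : Prop :=
  forall D, measurable D -> (0 < mu D)%E ->
    exists B, [/\ measurable B, B `<=` D, (0 < mu B)%E & (mu B < mu D)%E].

Definition is_sub_sigma_algebra G : Prop :=
  sigma_algebra [set: T] G /\ G `<=` measurable.

Definition sub_atom mu G D : Prop :=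
  [/\ measurable D, (0 < mu D)%E &
    forall D1, measurable D1 ->
      exists2 D2, G D2 & mu ((D `&` D1) `+` (D `&` D2)) = 0%E].

Definition is_cond_exp mu G (h e : T -> R) : Prop :=
  [/\ measurable_fun [set: g_sigma_algebraType G] e,
      mu.-integrable [set: T] (EFin \o e) &
      forall B, G B ->
        (\int[mu]_(w in B) (e w)%:E = \int[mu]_(w in B) (h w)%:E)%E].

(* A chosen version; [cond_expP] shows that one exists when [h] is integrable,
   and the value is junk otherwise. *)
Definition cond_exp mu G (h : T -> R) : T -> R :=
  get [set e | is_cond_exp mu G h e].

Definition cond_expv n mu G (h : T -> 'rV[R]_n) : T -> 'rV[R]_n :=
  fun w => \row_i cond_exp mu G (fun w' => h w' ord0 i) w.

Lemma cond_expP mu G (h : T -> R) : is_sub_sigma_algebra G ->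
  mu.-integrable [set: T] (EFin \o h) -> is_cond_exp mu G h (cond_exp mu G h).
Proof.
move=> [sG GT] hi.
suff: exists e, is_cond_exp mu G h e by move=> he; exact: (getPex he).
have GE : <<s G >> = G by exact: sigma_algebra_id.
pose f : T -> g_sigma_algebraType G := id.
have mf : measurable_fun [set: T] f.
  by move=> _ B mB; rewrite setTI; apply: GT; rewrite -GE.
pose f' : {mfun T >-> g_sigma_algebraType G} :=
  HB.pack f (isMeasurableFun.Build _ _ _ _ f mf).
pose m : probability (g_sigma_algebraType G) R := distribution mu f'.
have [nu nuE] : exists nu : {charge set (g_sigma_algebraType G) -> \bar R},
    forall B, nu B = (\int[mu]_(w in B) (h w)%:E)%E.
  by unshelve eexists (pushforward (induced_charge hi) f).
have numu : nu `<< m.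
  apply/null_content_dominatesP => B mB mB0; rewrite nuE.
  have mB' : measurable (B : set T).
    by rewrite -[B]setTI; exact: (mf measurableT B mB).
  apply: null_set_integral => //.
  by apply: measurable_funTS; exact: measurable_int hi.
pose e0 : g_sigma_algebraType G -> \bar R := Radon_Nikodym nu m.
have ie0 : m.-integrable [set: g_sigma_algebraType G] e0.
  exact: Radon_Nikodym_integrable.
have me0 := measurable_int _ ie0.
have e0E w : (fine (e0 w))%:E = e0 w by rewrite fineK// Radon_Nikodym_fin_num.
have me0f : measurable_fun [set: T] (e0 \o f) by exact: measurableT_comp.
have ie : mu.-integrable [set: T] (e0 \o f).
  apply/integrableP; split; first exact: me0f.
  have /integrableP[_] := ie0; rewrite ge0_integral_pushforward//=.
  exact: measurableT_comp.
exists (fine \o e0); split.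
- exact: measurableT_comp.
- by apply: eq_integrable ie => // w _; rewrite /= e0E.
- move=> B GB; have mB : measurable (B : set (g_sigma_algebraType G)).
    by rewrite /measurable/= GE.
  under eq_integral do rewrite /= e0E.
  rewrite -nuE (Radon_Nikodym_integral numu mB) integral_pushforward//=.
  apply: integrableS ie => //; exact: GT.
Qed.

End sub_sigma_algebras.

Section decisions.
Context d (Omega : measurableType d) (R : realType).
Context (X : completeMetricType R) (A : Omega -> set X).

Definition graph : set (Omega * borel X) := [set p | A p.1 p.2].

Definition randomized_decision (phi : Omega -> probability (borel X) R) : Prop :=
  measurable_fun [set: Omega] (phi : Omega -> borel (weak_probability R X)) /\
  forall w, phi w (A w) = 1%E.

Definition decision (f : Omega -> X) : Prop :=
  measurable_fun [set: Omega] (f : Omega -> borel X) /\ forall w, A w (f w).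

Definition I_randomized n (g : 'I_n -> Omega * borel X -> R)
    (phi : Omega -> probability (borel X) R) : Omega -> 'rV[R]_n :=
  fun w => \row_i \int[phi w]_(x in A w) g i (w, x).

Definition I_pure n (g : 'I_n -> Omega * borel X -> R) (f : Omega -> X) :
    Omega -> 'rV[R]_n :=
  fun w => \row_i g i (w, f w).

End decisions.

(* Main.v *)
(* It is enough to find a measurable selection f of A with
   \int_B g(w, f w) = \int_B \int g(w, x) phi(w)(dx) for all B in G: the two
   conditional expectations then have the same versions.

   Conditional Lyapunov theorem.  Let h_1, ..., h_n be integrable.  Without
   G-atoms every measurable set E has a measurable subset D such that
   \int_(D /\ B) h_i = 1/2 \int_(E /\ B) h_i for all B in G and all i, and
   mu (D /\ B) = 1/2 mu (E /\ B).  For n = 0, a maximal D with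
   mu (D /\ B) <= 1/2 mu (E /\ B) works.  For the induction step, start from a
   half of E for the old functions and its complement, one of which is heavy and
   the other light for the new function on each piece of a Hahn decomposition
   of G; exchanging halves of their differences produces
   adjacent heavy and light halves that differ by a set of measure 2^-k, and
   these converge to an exact half.  Reading the binary digits of a weight
   p : Omega -> [0, 1] turns halving into a set D with
   \int_(D /\ B) h_i = \int_B p h_i.

   Purification.  A measurable E in Omega * X with nonnull sections stands for
   the kernel phi(w)(. | E_w).  Cutting E by C, the Lyapunov theorem with weight
   phi(w)(C_w | E_w) selects E_w /\ C_w or E_w \ C_w for each w without changing
   the integrals of the payoffs over the sets of G.  By inner regularity,
   Omega * X is covered, up to a null set, by countably many sets with closed
   sections of small diameter on which g oscillates little.  Cutting by finitely
   many of them at a time, with the remaining part as an additional payoff,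
   yields a decreasing sequence whose sections shrink to a point f(w) and along
   which the averages of g converge to g(w, f w).  The constraint f w \in A w
   is the payoff \1_(~` graph A), whose integral is 0, so no measurable selection
   theorem is required: completeness of mu repairs f on a null set. *)
From HB Require Import structures.
Require Import Defs.
From mathcomp Require Import all_boot all_order all_algebra.
From mathcomp Require Import all_classical all_reals all_analysis.
From mathcomp Require Import measurable_realfun.
From mathcomp Require Import ring lra.

Set Implicit Arguments.
Unset Strict Implicit.
Unset Printing Implicit Defensive.

Import Order.TTheory GRing.Theory Num.Theory.
Import numFieldTopology.Exports numFieldNormedType.Exports.

Local Open Scope classical_set_scope.
Local Open Scope ring_scope.

(** * Recursive choices and powers of one half *)

(** The choice is made on the subtype of pairs of a stage and an element; carrying the stage lets
    the invariant [P] depend on it. *)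
Lemma dependent_choice_inv (A : Type) (P : nat -> A -> Prop) (r : A -> A -> Prop)
    (a0 : A) : P 0 a0 ->
  (forall k a, P k a -> exists2 b, P k.+1 b & r a b) ->
  exists f : nat -> A, [/\ f 0 = a0, forall k, P k (f k) &
    forall k, r (f k) (f k.+1)].
Proof.
move=> P0 step.
pose S := {ka : nat * A | P ka.1 ka.2}.
pose rS (x y : S) := (sval y).1 = (sval x).1.+1 /\ r (sval x).2 (sval y).2.
have [|f [f0 fS]] := @dependent_choice S rS _ (exist _ (0%N, a0) P0).
  move=> [[k a] /= Pa]; apply: cid; have [b Pb ab] := step _ _ Pa.
  by exists (exist _ (k.+1, b) Pb).
have f1 k : (sval (f k)).1 = k.
  by elim: k => [|k IH]; [rewrite f0|rewrite (fS k).1 IH].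
exists (fun k => (sval (f k)).2); split => [|k|k]; first by rewrite f0.
  by have := svalP (f k); rewrite f1.
by case: (fS k).
Qed.

(** The powers of 1/2 tend to 0. It is applied by contradiction, to find a stage [k] at which
    [a / 2 ^+ k] lies below a given positive bound. *)
Lemma le0_halves (R : realType) (x a : R) :
  (forall k : nat, x <= a / 2 ^+ k) -> x <= 0.
Proof.
move=> xa; rewrite leNgt; apply/negP => x0.
have : \forall k \near \oo, a * 2^-1 ^+ k < x.
  have : a * 2^-1 ^+ k @[k --> \oo] --> (0 : R).
    rewrite -(mulr0 a); apply: cvgMr; apply: cvg_expr.
    by rewrite ger0_norm// invf_lt1// ltr1n.
  by move=> /cvgr_lt; exact.
move=> [k _ /(_ k (leqnn k))]/=; rewrite exprVn.
by rewrite ltNge xa.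
Qed.

(** * Integrals over varying sets *)

(** The set comes last so that [set_integral mu h] is a real-valued set function. With [h = cst 1]
    it is [mu] on measurable sets, as a real number, which brings comparisons of measures within
    reach of linear arithmetic. *)
Definition set_integral d (T : measurableType d) (R : realType)
    (mu : probability T R) (h : T -> R) (A : set T) : R :=
  \int[mu]_(w in A) h w.

Section set_integral.
Context d (T : measurableType d) (R : realType) (mu : probability T R).
Implicit Types (A B C D E : set T) (f g h : T -> R).

Local Notation J := (set_integral mu).
Local Notation m := (set_integral mu (cst 1)).
Local Notation integrable h := (mu.-integrable [set: T] (EFin \o h)).

Lemma integrable_cst1 : integrable (cst 1).
Proof.
exact: finite_measure_integrable_cst.
Qed.

Lemma set_integral1 A : measurable A -> m A = fine (mu A).
Proof. by move=> mA; rewrite /set_integral Rintegral_cst// mul1r. Qed.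

Lemma prob_set_integral1 A : measurable A -> mu A = (m A)%:E.
Proof. by move=> mA; rewrite set_integral1// fineK// fin_num_measure. Qed.

Lemma set_integral1_ge0 A : 0 <= m A.
Proof. exact: Rintegral_ge0. Qed.

Lemma set_integral_setU h A B : integrable h -> measurable A -> measurable B ->
  A `&` B `<=` set0 -> J h (A `|` B) = J h A + J h B.
Proof.
move=> ih mA mB AB; rewrite /set_integral Rintegral_setU//.
  by apply: integrableS ih => //; exact: measurableU.
by exact/disj_setPS.
Qed.

Lemma set_integral_setID h A B : integrable h -> measurable A -> measurable B ->
  J h A = J h (A `&` B) + J h (A `\` B).
Proof.
move=> ih mA mB; rewrite -set_integral_setU ?setUIDK//;
  [exact: measurableI|exact: measurableD|].
by move=> w [[_ ?] [_ ?]].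
Qed.

Lemma set_integral1_le A B : measurable A -> measurable B -> A `<=` B -> m A <= m B.
Proof.
move=> mA mB AB; rewrite (set_integral_setID integrable_cst1 mB mA) setIidr// lerDl.
exact: set_integral1_ge0.
Qed.

(** Continuity of [mu] from below. *)
Lemma set_integral1_bigcup_small (F : nat -> set T) e : (forall k, measurable (F k)) ->
  (forall k, F k `<=` F k.+1) -> 0 < e ->
  exists k, m (\bigcup_k F k `\` F k) < e.
Proof.
move=> mF ndF e0; have mU : measurable (\bigcup_k F k) by exact: bigcup_measurable.
have nd : nondecreasing_seq F by apply/nondecreasing_seqP => k; exact/subsetPset.
have := nondecreasing_cvg_mu (mu := mu) mF mU nd.
rewrite [X in _ --> X -> _](prob_set_integral1 mU) => /fine_cvg/cvgr_distC_lt/(_ e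
  e0)[k _ /(_ k (leqnn k))]/=.
rewrite -set_integral1// => H; exists k; apply: le_lt_trans H.
rewrite (set_integral_setID integrable_cst1 mU (mF k)) setIidr; last exact: bigcup_sup.
by rewrite opprD addNKr normrN ger0_norm// set_integral1_ge0.
Qed.

Lemma set_integral_mul_indic h E A : integrable h -> measurable E -> measurable A ->
  J (h \* \1_E) A = J h (E `&` A).
Proof.
move=> ih set_integral1 mA; rewrite /set_integral setIC Rintegral_mkcondr;
  apply: eq_Rintegral.
by move=> w _; rewrite patchE /= indicE; case: ifPn; rewrite ?mulr1 ?mulr0.
Qed.

Lemma set_integralD f g A : integrable f -> integrable g -> measurable A ->
  J (f \+ g) A = J f A + J g A.
Proof.
by move=> iF ig mA; apply: RintegralD => //; exact: integrableS (subsetT _) _.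
Qed.

Lemma set_integralB f g A : integrable f -> integrable g -> measurable A ->
  J (f \- g) A = J f A - J g A.
Proof.
by move=> iF ig mA; apply: RintegralB => //; exact: integrableS (subsetT _) _.
Qed.

Lemma set_integralZ r f A : integrable f -> measurable A -> J (fun w => r * f w) A =
  r * J f A.
Proof.
by move=> iF mA; apply: RintegralZl => //; exact: integrableS (subsetT _) _.
Qed.

Lemma eq_set_integral f g A : (forall w, A w -> f w = g w) -> J f A = J g A.
Proof. by move=> fg; apply: eq_Rintegral => w /set_mem; exact: fg. Qed.

Lemma integrable_bound h f : integrable h -> measurable_fun [set: T] f ->
  (forall w, `|f w| <= `|h w|) -> integrable f.
Proof.
move=> ih mf fh; apply: le_integrable ih => //; first exact/measurable_EFinP.
by move=> w _; rewrite /= lee_fin.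
Qed.

Lemma integrable_mul h f : integrable h -> measurable_fun [set: T] f ->
  (forall w, `|f w| <= 1) -> integrable (h \* f).
Proof.
move=> ih mf f1.
have mh : measurable_fun [set: T] h by apply/measurable_EFinP; exact: measurable_int ih.
apply: integrable_bound ih _ _; first exact: measurable_funM.
by move=> w; rewrite /= normrM ler_piMr.
Qed.

Lemma integrable_mul_indic h E : integrable h -> measurable E -> integrable (h \* \1_E).
Proof.
move=> ih set_integral1; apply: integrable_mul => // w.
by rewrite indicE; case: (_ \in _); rewrite ?normr1// normr0.
Qed.

(** Absolute continuity of the integral, with one [r] for all [f] dominated by [h]. In
    [split_integrable] the integrand varies with the stage, while [r] has to be fixed before the
    stage is chosen. *)
Lemma set_integral_small h e : integrable h -> 0 < e -> exists2 r, 0 < r &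
  forall A, measurable A -> m A < r ->
  forall f, integrable f -> (forall w, `|f w| <= `|h w|) -> `|J f A| < e.
Proof.
move=> ih e0; have [r [r0 H]] := integral_normr_continuous ih e0.
exists r => // A mA Ar f iF fh.
have {}Ar : (mu A < r%:E)%E by rewrite prob_set_integral1// lte_fin.
apply: le_lt_trans (H A mA Ar).
apply: le_trans (le_normr_Rintegral mA _) _; first exact: integrableS iF.
apply: le_Rintegral => //.
  exact: integrableS (integrable_norm iF).
exact: integrableS (integrable_norm ih).
Qed.

End set_integral.

(** * Closure properties of the sub-sigma-algebra *)

Section sub_sigma_algebra_theory.
Context d (T : measurableType d) (G : set (set T)).
Context (Gsub : is_sub_sigma_algebra G).

Lemma subG_measurable A : G A -> measurable A.
Proof. exact: Gsub.2. Qed.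

Lemma subG_setC A : G A -> G (~` A).
Proof. by rewrite -setTD; case: Gsub => -[_ + _] _; exact. Qed.

Lemma subG_setT : G [set: T].
Proof. by rewrite -setC0; apply: subG_setC; case: Gsub => -[]. Qed.

Lemma subG_setI A B : G A -> G B -> G (A `&` B).
Proof.
move=> GA GB; have GE : <<s G >> = G by apply: sigma_algebra_id; case: Gsub.
rewrite -GE; apply: (@measurableI _ (g_sigma_algebraType G)).
- by rewrite /measurable/= GE.
- by rewrite /measurable/= GE.
Qed.

End sub_sigma_algebra_theory.

(** * Hahn decompositions whose sets lie in the sub-sigma-algebra *)

Section halving.
Context d (T : measurableType d) (R : realType) (mu : probability T R).
Context (G : set (set T)) (Gsub : is_sub_sigma_algebra G).
Implicit Types (A B C D E : set T) (f g h : T -> R).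

Local Notation J := (set_integral mu).
Local Notation m := (set_integral mu (cst 1)).
Local Notation integrable h := (mu.-integrable [set: T] (EFin \o h)).

Let Gm A : G A -> measurable A. Proof. exact: subG_measurable. Qed.

Lemma sub_hahn h : integrable h -> exists B, [/\ G B,
  forall B', G B' -> B' `<=` B -> 0 <= J h B' &
  forall B', G B' -> B' `<=` ~` B -> J h B' <= 0].
Proof.
(* [B] is the set where a conditional expectation of [h] is nonnegative. *)
move=> ih; have [me ie eE] := cond_expP Gsub ih.
set e := cond_exp mu G h in me ie eE *.
have GE : <<s G >> = G by apply: sigma_algebra_id; case: Gsub.
have JE B : G B -> J h B = J e B.
  by move=> GB; rewrite /set_integral /Rintegral eE.
exists [set w | 0 <= e w]; split.
- have := me measurableT `[0, +oo[%classic (measurable_itv _).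
  rewrite setTI /measurable/= GE; congr G.
  by apply/seteqP; split => w /=; rewrite in_itv/= andbT.
- by move=> B' GB' B'e; rewrite JE//; apply: Rintegral_ge0 => w /B'e.
- move=> B' GB' B'e; have mB' := Gm GB'; rewrite JE// -oppr_ge0.
  have -> : - J e B' = J (fun w => - e w) B'.
    rewrite -mulN1r /set_integral -RintegralZl//; last first.
      exact: integrableS ie.
    by apply: eq_Rintegral => w _; rewrite mulN1r.
  apply: Rintegral_ge0 => w /B'e /negP; rewrite -ltNge oppr_ge0; exact: ltW.
Qed.

End halving.

(** * Halving sets conditionally on the sub-sigma-algebra *)

Section half_measure.
Context d (T : measurableType d) (R : realType) (mu : probability T R).
Context (G : set (set T)) (Gsub : is_sub_sigma_algebra G).
Context (noatom : forall D, ~ sub_atom mu G D).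
Implicit Types (A B C D E : set T) (f g h : T -> R).

Local Notation J := (set_integral mu).
Local Notation m := (set_integral mu (cst 1)).
Local Notation integrable h := (mu.-integrable [set: T] (EFin \o h)).

Let Gm A : G A -> measurable A. Proof. exact: subG_measurable. Qed.
Let i1 := integrable_cst1 mu.

(** As [E] is not an atom, some [D1] cuts it into [P] and [Q] in a way that no set of [G] reproduces
    up to a null set. A Hahn set [B] for the difference of the indicators of [P] and [Q] tells where
    [Q] is the lighter of the two; gluing [Q] on [B] with [P] off [B] gives at most half of [E] over
    every set of [G]. The glued set is the symmetric difference of the traces of [D1] and [B] on
    [E], so it is not null. *)
Lemma light_part E : measurable E -> 0 < m E -> exists E',
  [/\ measurable E', E' `<=` E, 0 < m E' &
    forall B, G B -> m (E' `&` B) * 2 <= m (E `&` B)].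
Proof.
move=> mE mE0.
have [D1 mD1 D1P] : exists2 D1, measurable D1 & forall D2, G D2 ->
    mu ((E `&` D1) `+` (E `&` D2)) <> 0%E.
  apply: contrapT => H; apply: (noatom (D := E)); split => //.
    by rewrite prob_set_integral1// lte_fin.
  move=> D1 mD1; apply: contrapT => H2; apply: H; exists D1 => // D2 GD2 H0.
  by apply: H2; exists D2.
pose P := E `&` D1; pose Q := E `\` D1.
have mP : measurable P by exact: measurableI.
have mQ : measurable Q by exact: measurableD.
have iP := integrable_mul_indic i1 mP.
have iQ := integrable_mul_indic i1 mQ.
have ih : integrable ((cst 1 \* \1_P) \- (cst 1 \* \1_Q)).
  exact: (integrableB measurableT iP iQ).
have [B [GB Bge Ble]] := sub_hahn Gsub ih.
have mB := Gm GB.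
have JE B' : measurable B' -> J ((cst 1 \* \1_P) \- (cst 1 \* \1_Q)) B' =
    m (P `&` B') - m (Q `&` B').
  by move=> mB'; rewrite set_integralB// !set_integral_mul_indic.
exists ((Q `&` B) `|` (P `\` B)); split.
- by apply: measurableU; [exact: measurableI|exact: measurableD].
- by move=> w [[[]//]|[[]//]].
- have := D1P _ GB; apply: contra_notT; rewrite -leNgt => E'0.
  have -> : (E `&` D1) `+` (E `&` B) = (Q `&` B) `|` (P `\` B).
    by apply/seteqP; split => w /=; rewrite /setY/P/Q/setD/=; tauto.
  have mE' : measurable ((Q `&` B) `|` (P `\` B)).
    by apply: measurableU; [exact: measurableI|exact: measurableD].
  by rewrite prob_set_integral1//; congr EFin; apply/eqP;
    rewrite eq_le E'0 set_integral1_ge0.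
- move=> B' GB'; have mB' := Gm GB'.
  have mBB' : measurable (B' `&` B) by exact: measurableI.
  have mB'B : measurable (B' `\` B) by exact: measurableD.
  have := Bge (B' `&` B) (subG_setI Gsub GB' GB) (@subIsetr _ _ _).
  have := Ble (B' `\` B).
  rewrite {1}setDE => /(_ (subG_setI Gsub GB' (subG_setC Gsub GB)) (@subIsetr _ _ _)).
  rewrite !JE//.
  have mE' : measurable ((Q `&` B) `|` (P `\` B)).
    by apply: measurableU; [exact: measurableI|exact: measurableD].
  rewrite (set_integral_setID i1 (measurableI _ _ mE' mB') mB).
  rewrite (set_integral_setID i1 (measurableI _ _ mE mB') mD1).
  rewrite (set_integral_setID i1 (measurableI _ _ (measurableI _ _ mE mB') mD1) mB).
  rewrite (set_integral_setID i1 (measurableD (measurableI _ _ mE mB') mD1) mB).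
  rewrite (_ : (_ `|` _) `&` B' `&` B = Q `&` (B' `&` B)); last first.
    by apply/seteqP; split => w /=; tauto.
  rewrite (_ : ((_ `|` _) `&` B') `\` B = P `&` (B' `\` B)); last first.
    by apply/seteqP; split => w /=; tauto.
  rewrite (_ : _ `&` D1 `&` B = P `&` (B' `&` B)); last first.
    by apply/seteqP; split => w /=; rewrite /P/=; tauto.
  rewrite (_ : (_ `&` D1) `\` B = P `&` (B' `\` B)); last first.
    by apply/seteqP; split => w /=; rewrite /P/=; tauto.
  rewrite (_ : (_ `\` D1) `&` B = Q `&` (B' `&` B)); last first.
    by apply/seteqP; split => w /=; rewrite /Q/=; tauto.
  rewrite (_ : _ `\` D1 `\` B = Q `&` (B' `\` B)); last first.
    by apply/seteqP; split => w /=; rewrite /Q/=; tauto.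
  lra.
Qed.

Lemma small_part E k : measurable E -> 0 < m E -> exists E',
  [/\ measurable E', E' `<=` E, 0 < m E' &
    forall B, G B -> m (E' `&` B) * 2 ^+ k <= m (E `&` B)].
Proof.
move=> mE mE0; elim: k => [|k [E' [mE' E'E E'0 IH]]].
  by exists E; split => // B _; rewrite expr0 mulr1.
have [E2 [mE2 E2E E20 E2P]] := light_part mE' E'0.
exists E2; split => //; first exact: subset_trans E'E.
move=> B GB; apply: le_trans (IH B GB); rewrite exprS mulrA.
by rewrite ler_pM2r ?exprn_gt0// E2P.
Qed.

Lemma half_measure E : measurable E -> exists D,
  [/\ measurable D, D `<=` E &
    forall B, G B -> m (D `&` B) * 2 = m (E `&` B)].
Proof.
move=> mE.
pose Fam D := [/\ measurable D, D `<=` E &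
  forall B, G B -> m (D `&` B) * 2 <= m (E `&` B)].
(* Each step realizes at least half of the largest possible gain in measure. *)
have step (k : nat) D : Fam D -> exists2 D', Fam D' & D `<=` D' /\
    forall D'', Fam D'' -> D `<=` D'' -> m D'' - m D <= (m D' - m D) * 2.
  move=> FD; pose S := [set m D'' | D'' in [set D'' | Fam D'' /\ D `<=` D'']].
  have S0 : S (m D) by exists D; first split.
  have Sub : has_sup S.
    split; first by exists (m D).
    exists (m E) => _ [D'' [[mD'' D''E _] _] <-]; exact: set_integral1_le.
  have [e|e] := ltP (m D) (sup S); last first.
    exists D => //; split => // D'' FD'' DD''; rewrite subrr mul0r subr_le0.
    by apply: le_trans e; apply: ub_le_sup; [case: Sub|exists D''].
  have e0 : 0 < (sup S - m D) / 2 by lra.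
  have [_ [D' [FD' DD'] <-] D'e] := sup_adherent e0 Sub.
  exists D' => //; split => // D'' FD'' DD''.
  have : m D'' <= sup S by apply: ub_le_sup; [case: Sub|exists D''].
  lra.
have Fam0 : Fam set0.
  split => //; move=> B GB; have mB := Gm GB.
  by rewrite set0I {1}/set_integral Rintegral_set0 mul0r set_integral1_ge0.
have [F [F0 FF Fstep]] := dependent_choice_inv (P := fun _ => Fam) Fam0 step.
pose D := \bigcup_k F k.
have mF k : measurable (F k) by case: (FF k).
have mD : measurable D by exact: bigcup_measurable.
have ndF k : F k `<=` F k.+1 by case: (Fstep k).
have FD k : F k `<=` D by exact: bigcup_sup.
have Dsmall e : 0 < e -> exists k, m (D `\` F k) < e.
  by move=> e0; exact: set_integral1_bigcup_small.
have DE : D `<=` E by move=> w [k _]; case: (FF k) => _ + _; exact.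
have FamD : Fam D.
  split => // B GB; have mB := Gm GB.
  rewrite -subr_le0; apply/ler_addgt0Pr => e e0; rewrite add0r.
  have [k kP] := Dsmall (e / 2) (divr_gt0 e0 (ltr0Sn R 1)).
  have [_ _ /(_ _ GB)] := FF k.
  rewrite (set_integral_setID i1 (measurableI _ _ mD mB) (mF k)).
  have -> : D `&` B `&` F k = F k `&` B.
    by apply/seteqP; split => w /= ; have := FD k w; tauto.
  have : m ((D `&` B) `\` F k) <= m (D `\` F k).
    apply: set_integral1_le; [|exact: measurableD|by move=> w [[]]].
    by apply: measurableD => //; exact: measurableI.
  lra.
(* The possible gain over [F k] is at most twice the gain realized by [F k.+1], hence at most twice
   the measure of what [D] adds to [F k], which tends to 0. *)
have Dmax D' : Fam D' -> D `<=` D' -> m D' <= m D.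
  move=> FD' DD'; apply/ler_addgt0Pr => e e0.
  have [k kP] := Dsmall (e / 2) (divr_gt0 e0 (ltr0Sn R 1)).
  have [_ /(_ _ FD' (subset_trans (FD k) DD'))] := Fstep k.
  have : m (F k.+1) <= m D by exact: set_integral1_le.
  rewrite (set_integral_setID i1 mD (mF k)) setIidr//; move: kP; set x := m _;
    set y := m _; set z := m _.
  have : m (F k) <= m D' by apply: set_integral1_le => //;
    [by case: FD'|exact: subset_trans DD'].
  lra.
exists D; split => // B0 GB0; apply/eqP; rewrite eq_le.
have [_ _ DP] := FamD; rewrite DP//= leNgt; apply/negP => ltB0.
(* [lam] is the slack left by [D]: additive, nonnegative on [G], and of positive total if equality
   fails on [B0]. *)
pose lam B := m (E `&` B) - m (D `&` B) * 2.
have lam_ge0 B : G B -> 0 <= lam B by move=> GB; rewrite subr_ge0 DP.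
have lamU B B' : measurable B -> measurable B' -> lam B = lam (B `&` B') + lam (B `\` B').
  move=> mB mB'; rewrite /lam.
  rewrite (set_integral_setID i1 (measurableI _ _ mE mB) mB') (set_integral_setID i1
    (measurableI _ _ mD mB) mB').
  by rewrite -!setIA -!setIDA; lra.
have mB0 := Gm GB0.
have lamT : 0 < lam setT.
  have := lamU setT B0 measurableT mB0; rewrite setTI setTD => ->.
  rewrite ltr_wpDr//; last by rewrite /lam; lra.
  exact: lam_ge0 (subG_setC Gsub GB0).
have [k kP] : exists k : nat, 1 / 2 ^+ k < lam setT.
  apply: contrapT => H; have : lam setT <= 0; last by rewrite leNgt lamT.
  apply: (@le0_halves _ _ 1) => k; rewrite leNgt; apply/negP => H2; apply: H.
  by exists k.
(* The integral of [h] is the slack minus [2 ^- k] times the measure, with positive total. Its Hahn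
   set [B] is therefore not negligible, and over every subset of [B] in [G] the slack is at least
   [2 ^- k] times the measure. *)
pose h := (cst 1 \* \1_E) \- (fun w => 2 * (cst 1 \* \1_D) w) \- (fun w => (2 ^+
  k)^-1 * cst 1 w) : T -> R.
have iE := integrable_mul_indic i1 mE.
have iD := integrable_mul_indic i1 mD.
have iD2 : integrable (fun w => 2 * (cst 1 \* \1_D) w).
  exact: (integrableZl measurableT 2 iD).
have ik : integrable (fun w => (2 ^+ k)^-1 * cst 1 w).
  exact: (integrableZl measurableT _ i1).
have iED : integrable ((cst 1 \* \1_E) \- (fun w => 2 * (cst 1 \* \1_D) w)).
  exact: (integrableB measurableT iE iD2).
have ih : integrable h by exact: (integrableB measurableT iED ik).
have Jh B : measurable B -> J h B = lam B - (2 ^+ k)^-1 * m B.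
  move=> mB; rewrite /h set_integralB// set_integralB// (set_integralZ 2 iD mB)
    (set_integralZ _ i1 mB) !set_integral_mul_indic//.
  by rewrite /lam [2 * _]mulrC.
have [B [GB Bge Ble]] := sub_hahn Gsub ih.
have mB := Gm GB.
have mT1 : m setT = 1 by rewrite set_integral1// probability_setT.
have JB0 : 0 < J h B.
  have := Ble _ (subG_setC Gsub GB) (@subset_refl _ _).
  have : 0 < J h setT by rewrite Jh// mT1 mulr1 subr_gt0 -div1r.
  by rewrite (set_integral_setID ih measurableT mB) setTI setTD; lra.
have mED : measurable ((E `\` D) `&` B).
  by apply: measurableI => //; exact: measurableD.
have mEDE B' : measurable B' -> m ((E `\` D) `&` B') = m (E `&` B') - m (D `&` B').
  move=> mB'; rewrite (set_integral_setID i1 (measurableI _ _ mE mB') mD).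
  rewrite (_ : _ `&` D = D `&` B'); last first.
    by apply/seteqP; split => w /=; have := DE w; tauto.
  rewrite (_ : (_ `&` _) `\` D = (E `\` D) `&` B'); last first.
    by apply/seteqP; split => w /=; tauto.
  by rewrite addrC addKr.
have ED0 : 0 < m ((E `\` D) `&` B).
  rewrite mEDE//; move: JB0; rewrite Jh//.
  have : 0 <= (2 ^+ k)^-1 * m B by rewrite mulr_ge0 ?invr_ge0 ?exprn_ge0//
    set_integral1_ge0.
  by have := set_integral1_ge0 mu (D `&` B); rewrite /lam; lra.
(* Adding [E'] to [D] consumes twice the measure of [E'] from the slack, hence the exponent [k.+1].
   The enlarged set contradicts the maximality of [D]. *)
have [E' [mE' E'E E'0 E'P]] := small_part k.+1 mED ED0.
have DE'U A : measurable A -> m ((D `|` E') `&` A) = m (D `&` A) + m (E' `&` A).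
  move=> mA; rewrite setIUl set_integral_setU//; [exact: measurableI|exact: measurableI|].
  by move=> w [[Dw _] [/E'E[[]]]].
have /Dmax : Fam (D `|` E').
  split; first exact: measurableU.
    by move=> w [/DE//|/E'E[[]]].
  move=> B' GB'; have mB' := Gm GB'; rewrite DE'U//.
  have := Bge _ (subG_setI Gsub GB' GB) (@subIsetr _ _ _).
  have mB'B : measurable (B' `&` B) by exact: measurableI.
  have k0 : 0 < (2 ^+ k)^-1 :> R by rewrite invr_gt0 exprn_gt0.
  have : m (E' `&` B') * 2 <= (2 ^+ k)^-1 * m (B' `&` B).
    rewrite ler_pdivlMl ?exprn_gt0//; apply: (@le_trans _ _ (m ((E `\` D) `&` B `&` B'))).
      by apply: le_trans (E'P _ GB'); rewrite exprS; lra.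
    by apply: set_integral1_le => //; [exact: measurableI|move=> w [[_ ?] ?]].
  rewrite Jh//.
  have := lam_ge0 _ (subG_setI Gsub GB' (subG_setC Gsub GB)).
  by have := lamU B' B mB' mB; rewrite -setDE /lam; lra.
rewrite -[X in m X <= _]setIT DE'U// !setIT => /(_ (@subsetUl _ _ _)); lra.
Qed.

End half_measure.

(** * Simultaneous halving of finitely many integrals *)

Section halvable.
Context d (T : measurableType d) (R : realType) (mu : probability T R).
Context (G : set (set T)) (Gsub : is_sub_sigma_algebra G).
Implicit Types (A B C D E P Q : set T) (f g h : T -> R).

Local Notation J := (set_integral mu).
Local Notation m := (set_integral mu (cst 1)).
Local Notation integrable h := (mu.-integrable [set: T] (EFin \o h)).

(** A set of functions rather than an indexed family, so that the induction can adjoin one function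
    at a time. *)
Definition halvable (S : set (T -> R)) : Prop :=
  forall E, measurable E -> exists D, [/\ measurable D, D `<=` E &
    forall f, S f -> forall B, G B -> J f (D `&` B) * 2 = J f (E `&` B)].

Let Gm A : G A -> measurable A. Proof. exact: subG_measurable. Qed.
Let i1 := integrable_cst1 mu.

(** Gluing along a set of [G] preserves the linear identities and inequalities that both sets
    satisfy over all sets of [G]. *)
Let glue B A1 A2 := (A1 `&` B) `|` (A2 `\` B).

Let mglue B A1 A2 : measurable B -> measurable A1 -> measurable A2 ->
  measurable (glue B A1 A2).
Proof. by move=> *; apply: measurableU; [exact: measurableI|exact: measurableD]. Qed.

Let J_glue f B A1 A2 B' : integrable f -> measurable B -> measurable A1 ->
    measurable A2 -> measurable B' ->
  J f (glue B A1 A2 `&` B') = J f (A1 `&` (B' `&` B)) + J f (A2 `&` (B' `\` B)).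
Proof.
move=> iF mB mA1 mA2 mB'.
rewrite (set_integral_setID iF (measurableI _ _ (mglue mB mA1 mA2) mB') mB).
by congr (J f _ + J f _); apply/seteqP; split => w /=; rewrite /glue/=; tauto.
Qed.

Lemma set_integral_setDI f A1 A B : integrable f -> measurable A1 -> measurable A ->
  measurable B ->
  A1 `<=` A -> J f ((A `\` A1) `&` B) = J f (A `&` B) - J f (A1 `&` B).
Proof.
move=> iF mA1 mA mB A1A; rewrite (set_integral_setID iF (measurableI _ _ mA mB) mA1).
rewrite (_ : _ `&` A1 = A1 `&` B); last first.
  by apply/seteqP; split => w /=; have := A1A w; tauto.
rewrite addrAC subrr add0r; congr (J f _).
by apply/seteqP; split => w /=; tauto.
Qed.

Lemma set_integral_setUI f A1 A2 B : integrable f -> measurable A1 -> measurable A2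
  -> measurable B ->
  A1 `&` A2 `<=` set0 -> J f ((A1 `|` A2) `&` B) = J f (A1 `&` B) + J f (A2 `&` B).
Proof.
move=> iF mA1 mA2 mB A12; rewrite setIUl set_integral_setU//;
  [exact: measurableI|exact: measurableI|].
by move=> w [[? _] [? _]]; apply: (A12 w).
Qed.

(** This is [sub_hahn] for twice the restriction of [g] to [M] minus its restriction to [E]: [M]
    carries at least half of the integral of [g] on [B], and at most half off [B]. *)
Let hahn_half g E M : integrable g -> measurable E -> measurable M ->
  exists B, [/\ G B,
    forall B', G B' -> J g (E `&` (B' `&` B)) <= J g (M `&` (B' `&` B)) * 2 &
    forall B', G B' -> J g (M `&` (B' `\` B)) * 2 <= J g (E `&` (B' `\` B))].
Proof.
move=> ig mE mM.
have iE := integrable_mul_indic ig mE.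
have iM := integrable_mul_indic ig mM.
have iM2 : integrable (fun w => 2 * (g \* \1_M) w).
  exact: (integrableZl measurableT 2 iM).
have [B [GB Bge Ble]] := sub_hahn Gsub (integrableB measurableT iM2 iE).
have mB := Gm GB.
have JE B' : measurable B' -> J (fun w => 2 * (g \* \1_M) w - (g \* \1_E) w) B' =
    J g (M `&` B') * 2 - J g (E `&` B').
  by move=> mB'; rewrite set_integralB// (set_integralZ 2 iM mB')
    !set_integral_mul_indic// mulrC.
exists B; split => // B' GB'; have mB' := Gm GB'.
  have := Bge _ (subG_setI Gsub GB' GB) (@subIsetr _ _ _).
  by rewrite JE ?subr_ge0//; exact: measurableI.
have := Ble _ (subG_setI Gsub GB' (subG_setC Gsub GB)) (@subIsetr _ _ _).
by rewrite -setDE JE ?subr_le0//; exact: measurableD.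
Qed.

Section step.
Context (S : set (T -> R)) (g : T -> R) (ig : integrable g).
Context (hS : halvable S) (S1 : S (cst 1)) (iS : forall f, S f -> integrable f).
Context (E : set T) (mE : measurable E).

(* [s = (C, P, Q)]: the halves [C `|` P] and [C `|` Q] of [E] are respectively
   heavy and light for [g]. *)
Record pincer (k : nat) (s : set T * set T * set T) : Prop := Pincer {
  pincer_mC : measurable s.1.1;
  pincer_mP : measurable s.1.2;
  pincer_mQ : measurable s.2;
  pincer_sub : s.1.1 `|` s.1.2 `|` s.2 `<=` E;
  pincer_CP : s.1.1 `&` s.1.2 `<=` set0;
  pincer_CQ : s.1.1 `&` s.2 `<=` set0;
  pincer_PQ : s.1.2 `&` s.2 `<=` set0;
  pincer_SP : forall f, S f -> forall B, G B ->
    (J f (s.1.1 `&` B) + J f (s.1.2 `&` B)) * 2 = J f (E `&` B);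
  pincer_SQ : forall f, S f -> forall B, G B ->
    (J f (s.1.1 `&` B) + J f (s.2 `&` B)) * 2 = J f (E `&` B);
  pincer_gP : forall B, G B ->
    J g (E `&` B) <= (J g (s.1.1 `&` B) + J g (s.1.2 `&` B)) * 2;
  pincer_gQ : forall B, G B ->
    (J g (s.1.1 `&` B) + J g (s.2 `&` B)) * 2 <= J g (E `&` B);
  pincer_P0 : m s.1.2 * 2 ^+ k <= m E;
  pincer_Q0 : m s.2 * 2 ^+ k <= m E }.

(** Since [C] grows while the union of the three sets shrinks, every later [C] exceeds the present
    one only inside [P] and [Q]. *)
Let refine (s t : set T * set T * set T) : Prop :=
  s.1.1 `<=` t.1.1 /\ t.1.1 `|` t.1.2 `|` t.2 `<=` s.1.1 `|` s.1.2 `|` s.2.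

(** A half [D] for [S] and its complement in [E] share the integral of [g], so one is light wherever
    the other is heavy. Exchanging them across the Hahn set makes one half heavy and the other light
    everywhere; the common part is empty. *)
Let pincer0 : exists s, pincer 0 s.
Proof.
have [D [mD DE Dhalf]] := hS mE.
have [B [GB Bge Ble]] := hahn_half ig mE mD.
have mB := Gm GB.
have mED : measurable (E `\` D) by exact: measurableD.
have J0 f B' : J f (set0 `&` B') = 0 by rewrite set0I /set_integral Rintegral_set0.
exists (set0, glue B D (E `\` D), glue B (E `\` D) D); split => /=.
- exact: measurable0.
- exact: mglue.
- exact: mglue.
- by move=> w; rewrite /glue/=; have := DE w; tauto.
- by rewrite set0I.
- by rewrite set0I.
- by move=> w; rewrite /glue/=; tauto.
- move=> f Sf B' GB'; have mB' := Gm GB'; have iF := iS Sf.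
  rewrite J0 add0r J_glue// set_integral_setDI//; last exact: measurableD.
  have := Dhalf _ Sf _ (subG_setI Gsub GB' GB).
  have := Dhalf _ Sf _ (subG_setI Gsub GB' (subG_setC Gsub GB)).
  rewrite -setDE (set_integral_setID iF (measurableI _ _ mE mB') mB) -setIA -setIDA; lra.
- move=> f Sf B' GB'; have mB' := Gm GB'; have iF := iS Sf.
  rewrite J0 add0r J_glue// set_integral_setDI//; last exact: measurableI.
  have := Dhalf _ Sf _ (subG_setI Gsub GB' GB).
  have := Dhalf _ Sf _ (subG_setI Gsub GB' (subG_setC Gsub GB)).
  rewrite -setDE (set_integral_setID iF (measurableI _ _ mE mB') mB) -setIA -setIDA; lra.
- move=> B' GB'; have mB' := Gm GB'.
  rewrite J0 add0r J_glue// set_integral_setDI//; last exact: measurableD.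
  have := Bge _ GB'; have := Ble _ GB'.
  rewrite (set_integral_setID ig (measurableI _ _ mE mB') mB) -setIA -setIDA; lra.
- move=> B' GB'; have mB' := Gm GB'.
  rewrite J0 add0r J_glue// set_integral_setDI//; last exact: measurableI.
  have := Bge _ GB'; have := Ble _ GB'.
  rewrite (set_integral_setID ig (measurableI _ _ mE mB') mB) -setIA -setIDA; lra.
- by rewrite expr0 mulr1; apply: set_integral1_le => //;
  [exact: mglue|move=> w [[/DE//]|[[]//]]].
- by rewrite expr0 mulr1; apply: set_integral1_le => //;
  [exact: mglue|move=> w [[[]//]|[/DE//]]].
Qed.

Let pincer_step k s : pincer k s -> exists2 t, pincer k.+1 t & refine s t.
Proof.
case: s => [[C P] Q] [/= mC mP mQ CPQE CP CQ PQ SP SQ gP gQ P0' Q0'].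
(* [P] and [Q] have equal integrals of each function of [S] over sets of [G]. Trading half of [P]
   for half of [Q] thus turns a half of [E] for [S] into another one. *)
have [P0 [mP0 P0P P0h]] := hS mP.
have [Q0 [mQ0 Q0Q Q0h]] := hS mQ.
have mP1 : measurable (P `\` P0) by exact: measurableD.
have mQ1 : measurable (Q `\` Q0) by exact: measurableD.
have mCQ0 : measurable (C `|` Q0) by exact: measurableU.
have mCP1 : measurable (C `|` (P `\` P0)) by exact: measurableU.
have CQ0 : C `&` Q0 `<=` set0 by move=> w [? /Q0Q ?]; apply: (CQ w).
have CP1 : C `&` (P `\` P0) `<=` set0 by move=> w [? [? _]]; apply: (CP w).
have CQ0P1 : (C `|` Q0) `&` (P `\` P0) `<=` set0.
  by move=> w [[?|/Q0Q ?] [? _]]; [apply: (CP w)|apply: (PQ w)].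
have [B [GB Bge Ble]] := hahn_half ig mE (measurableU _ _ mCQ0 mP1).
have mB := Gm GB.
have JM B' : measurable B' -> J g ((C `|` Q0 `|` P `\` P0) `&` B') =
    J g (C `&` B') + J g (Q0 `&` B') + (J g (P `&` B') - J g (P0 `&` B')).
  by move=> mB'; rewrite !set_integral_setUI// set_integral_setDI.
(* The middle half [C `|` Q0 `|` (P `\` P0)] replaces the light half where it is
   light and the heavy half where it is heavy. *)
exists (glue B (C `|` Q0) (C `|` (P `\` P0)), glue B (P `\` P0) P0,
  glue B (Q `\` Q0) Q0); last first.
  split => w /=; first by rewrite /glue/=; have := EM (B w); tauto.
  by rewrite /glue/=; have := P0P w; have := Q0Q w; tauto.
split => /=; try exact: mglue.
- move=> w; have := CPQE w; rewrite /glue/=; have := P0P w; have := Q0Q w; tauto.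
- move=> w; have := CP w; have := PQ w; rewrite /glue/=; have := P0P w; have :=
  Q0Q w; tauto.
- move=> w; have := CQ w; have := PQ w; rewrite /glue/=; have := P0P w; have :=
  Q0Q w; tauto.
- move=> w; have := PQ w; rewrite /glue/=; have := P0P w; have := Q0Q w; tauto.
- move=> f Sf B' GB'; have mB' := Gm GB'; have iF := iS Sf.
  have GX := subG_setI Gsub GB' GB.
  have GY := subG_setI Gsub GB' (subG_setC Gsub GB); rewrite -setDE in GY.
  have mX := Gm GX; have mY := Gm GY.
  rewrite (set_integral_setID iF (measurableI _ _ mE mB') mB) -setIA -setIDA.
  rewrite !J_glue// !set_integral_setUI// !set_integral_setDI//.
  have := P0h _ Sf _ GX; have := Q0h _ Sf _ GX; have := SP _ Sf _ GX; have :=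
    SQ _ Sf _ GX.
  have := P0h _ Sf _ GY; have := Q0h _ Sf _ GY; have := SP _ Sf _ GY; have :=
    SQ _ Sf _ GY.
  lra.
- move=> f Sf B' GB'; have mB' := Gm GB'; have iF := iS Sf.
  have GX := subG_setI Gsub GB' GB.
  have GY := subG_setI Gsub GB' (subG_setC Gsub GB); rewrite -setDE in GY.
  have mX := Gm GX; have mY := Gm GY.
  rewrite (set_integral_setID iF (measurableI _ _ mE mB') mB) -setIA -setIDA.
  rewrite !J_glue// !set_integral_setUI// !set_integral_setDI//.
  have := P0h _ Sf _ GX; have := Q0h _ Sf _ GX; have := SP _ Sf _ GX; have :=
    SQ _ Sf _ GX.
  have := P0h _ Sf _ GY; have := Q0h _ Sf _ GY; have := SP _ Sf _ GY; have :=
    SQ _ Sf _ GY.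
  lra.
- move=> B' GB'; have mB' := Gm GB'.
  have GX := subG_setI Gsub GB' GB.
  have GY := subG_setI Gsub GB' (subG_setC Gsub GB); rewrite -setDE in GY.
  have mX := Gm GX; have mY := Gm GY.
  have := Bge _ GB'; have := Ble _ GB'; rewrite !JM//.
  rewrite (set_integral_setID ig (measurableI _ _ mE mB') mB) -setIA -setIDA.
  rewrite !J_glue// !set_integral_setUI// !set_integral_setDI//.
  by have := gP _ GY; lra.
- move=> B' GB'; have mB' := Gm GB'.
  have GX := subG_setI Gsub GB' GB.
  have GY := subG_setI Gsub GB' (subG_setC Gsub GB); rewrite -setDE in GY.
  have mX := Gm GX; have mY := Gm GY.
  have := Bge _ GB'; have := Ble _ GB'; rewrite !JM//.
  rewrite (set_integral_setID ig (measurableI _ _ mE mB') mB) -setIA -setIDA.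
  rewrite !J_glue// !set_integral_setUI// !set_integral_setDI//.
  by have := gQ _ GX; lra.
(* [cst 1] belongs to [S], so both parts of [P] have half its measure on [B] and off [B], and the
   glued set has half the measure of [P]. *)
- rewrite -[glue _ _ _]setIT J_glue// !setTI setTD set_integral_setDI//;
  try exact: measurableC.
  have := P0h _ S1 _ GB; have := P0h _ S1 _ (subG_setC Gsub GB).
  move: P0'; rewrite (set_integral_setID i1 mP mB) setDE exprS.
  set x := m _; set y := m _; set z := m _; set t := m _ => H1 H2 H3.
  apply: le_trans H1; rewrite mulrA; apply: ler_wpM2r; [exact: exprn_ge0|lra].
- rewrite -[glue _ _ _]setIT J_glue// !setTI setTD set_integral_setDI//;
  try exact: measurableC.
  have := Q0h _ S1 _ GB; have := Q0h _ S1 _ (subG_setC Gsub GB).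
  move: Q0'; rewrite (set_integral_setID i1 mQ mB) setDE exprS.
  set x := m _; set y := m _; set z := m _; set t := m _ => H1 H2 H3.
  apply: le_trans H1; rewrite mulrA; apply: ler_wpM2r; [exact: exprn_ge0|lra].
Qed.

(** [D] is the union of the common parts. What it adds to [C k] lies in the union of [P k] and
    [Q k], of measure at most [2 * m E / 2 ^+ k], so [D] inherits in the limit the exact equations
    for [S], and for [g] the bounds from both sides. *)
Lemma pincer_limit : exists D, [/\ measurable D, D `<=` E &
  forall f, S f \/ f = g -> forall B, G B -> J f (D `&` B) * 2 = J f (E `&` B)].
Proof.
have [s0 s0P] := pincer0.
have [s [_ sP s_]] := dependent_choice_inv s0P pincer_step.
pose C k := (s k).1.1; pose P k := (s k).1.2; pose Q k := (s k).2.
have mC k : measurable (C k) := pincer_mC (sP k).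
have mP k : measurable (P k) := pincer_mP (sP k).
have mQ k : measurable (Q k) := pincer_mQ (sP k).
pose D := \bigcup_k C k.
have mD : measurable D by exact: bigcup_measurable.
have CD k : C k `<=` D by exact: bigcup_sup.
have nested k j : C (k + j)%N `|` P (k + j)%N `|` Q (k + j)%N `<=` C k `|` P k `|` Q k.
  elim: j => [|j IH]; first by rewrite addn0.
  by rewrite addnS; apply: subset_trans IH; case: (s_ (k + j)%N).
have ndC k j : C k `<=` C (k + j)%N.
  elim: j => [|j IH]; first by rewrite addn0.
  by rewrite addnS; apply: subset_trans IH _; case: (s_ (k + j)%N).
have DC k : D `\` C k `<=` P k `|` Q k.
  move=> w [[l _ Clw] nCkw]; have [kl|lk] := leqP k l.
    have := nested k (l - k)%N w; rewrite subnKC// => /(_ (or_introl (or_introl Clw))).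
    by rewrite /=; tauto.
  by case: nCkw; have := ndC l (k - l)%N w; rewrite subnKC; [exact|exact: ltnW].
have DE : D `<=` E.
  by move=> w [k _ Ckw]; apply: (pincer_sub (sP k)); left; left.
have tail f e : integrable f -> 0 < e -> exists k, forall B, G B ->
    [/\ `|J f ((D `\` C k) `&` B)| < e, `|J f (P k `&` B)| < e & `|J f (Q k `&` B)| < e].
  move=> iF e0; have [r r0 small] := set_integral_small iF e0.
  have [k kP] : exists k : nat, m E / 2 ^+ k < r / 2.
    apply: contrapT => H; have : r / 2 <= 0; last by rewrite leNgt divr_gt0.
    apply: (@le0_halves _ _ (m E)) => k; rewrite leNgt; apply/negP => H2.
    by apply: H; exists k.
  have k0 : 0 < 2 ^+ k :> R by rewrite exprn_gt0.
  have Pr : m (P k) < r / 2.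
    by apply: le_lt_trans kP; rewrite ler_pdivlMr//; exact: (pincer_P0 (sP k)).
  have Qr : m (Q k) < r / 2.
    by apply: le_lt_trans kP; rewrite ler_pdivlMr//; exact: (pincer_Q0 (sP k)).
  have mDC : measurable (D `\` C k) by exact: measurableD.
  have DCr : m (D `\` C k) < r.
    apply: le_lt_trans (set_integral1_le mu mDC (measurableU _ _ (mP k) (mQ k)) (DC k)) _.
    by rewrite set_integral_setU//; [lra|exact: (pincer_PQ (sP k))].
  exists k => B GB; have mB := Gm GB.
  have sm A : measurable A -> m A < r -> `|J f (A `&` B)| < e.
    move=> mA Ar; apply: small => //; first exact: measurableI.
    by apply: le_lt_trans Ar; apply: set_integral1_le => //; exact: measurableI.
  by split; apply: sm => //; lra.
have JD2 f k B : integrable f -> measurable B ->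
    J f (D `&` B) = J f (C k `&` B) + J f ((D `\` C k) `&` B).
  move=> iF mB; rewrite (set_integral_setID iF (measurableI _ _ mD mB) (mC k)).
  by congr (J f _ + J f _); apply/seteqP; split => w /=; have := CD k w; tauto.
exists D; split => // f [Sf|->] B GB; have mB := Gm GB.
- apply/eqP; rewrite -subr_eq0 -normr_le0; apply/ler_addgt0Pr => e e0; rewrite add0r.
  (* Two small terms remain, each doubled, hence [e / 4]. *)
  have iF := iS Sf; have e40 : 0 < e / 4 by lra.
  have [k /(_ _ GB)[k1 k2 _]] := tail _ _ iF e40.
  rewrite (JD2 _ k)// -(pincer_SP (sP k) Sf GB) -/(C k) -/(P k).
  move: k1 k2; rewrite !ltr_norml ler_norml; lra.
- apply/eqP; rewrite -subr_eq0 -normr_le0; apply/ler_addgt0Pr => e e0; rewrite add0r.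
  have e40 : 0 < e / 4 by lra.
  have [k /(_ _ GB)[k1 k2 k3]] := tail _ _ ig e40.
  have := pincer_gP (sP k) GB; have := pincer_gQ (sP k) GB.
  rewrite -/(C k) -/(P k) -/(Q k) (JD2 _ k)//.
  move: k1 k2 k3; rewrite !ltr_norml ler_norml; lra.
Qed.

End step.

Lemma halvable_setU1 (S : set (T -> R)) g : halvable S -> S (cst 1) ->
  (forall f, S f -> integrable f) -> integrable g -> halvable (S `|` [set g]).
Proof. by move=> hS S1 iS ig E mE; exact: (pincer_limit ig hS S1 iS mE). Qed.

(** The conditional Lyapunov theorem, by induction along an enumeration of [I] starting from
    [half_measure]. [cst 1] is kept in the set throughout because the pincer needs the measures of
    [P] and [Q] to shrink. *)
Lemma halvable_fin (noatom : forall D, ~ sub_atom mu G D) (I : finType)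
    (h : I -> T -> R) : (forall i, integrable (h i)) ->
  halvable ([set cst 1] `|` range h).
Proof.
move=> ih.
suff H s : halvable ([set cst 1] `|` [set h i | i in [set` s : seq I]]).
  move=> E /(H (enum I))[D [mD DE DP]]; exists D; split => // f Sf; apply: DP.
  by case: Sf => [->|[i _ <-]]; [left|right; exists i => //=; rewrite mem_enum].
elim: s => [|i s IH].
  move=> E mE; have [D [mD DE DP]] := half_measure Gsub noatom mE.
  by exists D; split => // f [-> //|[]].
have : halvable (([set cst 1] `|` [set h i | i in [set` s]]) `|` [set h i]).
  apply: halvable_setU1 => //; first by left.
  by move=> f [->|[j _ <-]].
move=> H E /H[D [mD DE DP]]; exists D; split => // f Sf; apply: DP.
case: Sf => [->|[j /= + <-]]; first by left; left.
by rewrite inE => /predU1P[->|js]; [right|left; right; exists j].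
Qed.

End halvable.

(** * Splitting along a weight *)

Section split_by_weight.
Context d (T : measurableType d) (R : realType) (mu : probability T R).
Context (G : set (set T)) (Gsub : is_sub_sigma_algebra G).
Context (noatom : forall D, ~ sub_atom mu G D).
Implicit Types (A B C D E P Q : set T) (f g h : T -> R).

Local Notation J := (set_integral mu).
Local Notation m := (set_integral mu (cst 1)).
Local Notation integrable h := (mu.-integrable [set: T] (EFin \o h)).

Let Gm A : G A -> measurable A. Proof. exact: subG_measurable. Qed.
Let i1 := integrable_cst1 mu.

Section integrable_weight.
Context (I : finType) (h : I -> T -> R) (ih : forall i, integrable (h i)).
Context (p : T -> R) (mp : measurable_fun [set: T] p).
Context (p01 : forall w, 0 <= p w <= 1).

Let bitset (q : T -> R) : set T := [set w | 2^-1 <= q w].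

(* [bitset (doubling k)] is the set where the k-th binary digit of [p] is 1. *)
Fixpoint doubling (k : nat) : T -> R :=
  if k is k.+1 then fun w => 2 * doubling k w - \1_(bitset (doubling k)) w
  else p.

Let mbitset q : measurable_fun [set: T] q -> measurable (bitset q).
Proof.
move=> mq; rewrite /bitset -[X in measurable X]setTI.
have := mq measurableT `[2^-1, +oo[%classic (measurable_itv _); congr measurable.
by congr (_ `&` _); apply/seteqP; split => w /=; rewrite in_itv/= andbT.
Qed.

Let mdoubling k : measurable_fun [set: T] (doubling k).
Proof.
elim: k => [|k IH]//=; apply: measurable_funB; first exact: measurable_funM.
by apply: measurable_indic; exact: mbitset.
Qed.

Let doubling01 k w : 0 <= doubling k w <= 1.
Proof.
elim: k => [//|k IH] /=; rewrite indicE.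
have [/set_mem|/negP] := boolP (w \in bitset (doubling k)); rewrite /bitset/=.
  by lra.
by rewrite inE/= => /negP; rewrite -ltNge; lra.
Qed.

Let ihp i k : integrable (h i \* doubling k).
Proof.
by apply: integrable_mul => // w; rewrite ger0_norm; case/andP: (doubling01 k w).
Qed.

(* [s.1] is the undecided part, [s.2] the accepted part. *)
Record partial_split (k : nat) (s : set T * set T) : Prop := PartialSplit {
  split_mR : measurable s.1;
  split_mD : measurable s.2;
  split_RD : s.1 `&` s.2 `<=` set0;
  split_J : forall i B, G B ->
    J (h i) (s.2 `&` B) + J (h i \* doubling k) (s.1 `&` B) = J (h i \* p) B;
  split_R0 : m s.1 * 2 ^+ k <= 1 }.

Let refine (s t : set T * set T) : Prop :=
  s.2 `<=` t.2 /\ t.1 `|` t.2 `<=` s.1 `|` s.2.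

Let split0 : partial_split 0 (setT, set0).
Proof.
split => //=.
- by move=> i B GB; rewrite set0I setTI {1}/set_integral Rintegral_set0 add0r.
- by rewrite expr0 mulr1 set_integral1// probability_setT.
Qed.

(** Halve the undecided part by [V] for [h i], for its product with the current weight and for its
    product with the indicator of [U], the set where the current digit is 1. In [V] the digit
    decides: points of [U] are accepted, the others rejected. The other half stays undecided with
    the weight doubled minus the digit; the indicator of [U] has the same integrals against [h i] on
    both halves, so the balance [split_J] is kept. *)
Let split_step k s : partial_split k s ->
  exists2 t, partial_split k.+1 t & refine s t.
Proof.
case: s => [R0 D] [/= mR0 mD RD SJ SR0].
pose U := bitset (doubling k); have mU : measurable U by exact: mbitset.
pose F (x : I + (I + I)) := match x with
  | inl i => h i | inr (inl i) => h i \* doubling k | inr (inr i) => h i \* \1_U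
  end.
have iF x : integrable (F x).
  by case: x => [i|[i|i]] /=; [exact: ih|exact: ihp|exact: integrable_mul_indic].
have [V [mV VR VP]] := halvable_fin Gsub noatom iF mR0.
have VUR : (V `&` U) `&` (R0 `\` V) `<=` set0 by move=> w [[]? _ []].
have DVU : D `&` (V `&` U) `<=` set0 by move=> w [? [/VR ? _]]; apply: (RD w).
have mVU : measurable (V `&` U) by exact: measurableI.
have mRV : measurable (R0 `\` V) by exact: measurableD.
exists (R0 `\` V, D `|` (V `&` U)); last first.
  by split => w /=; have := VR w; tauto.
split => //=.
- exact: measurableU.
- by move=> w; have := RD w; have := VR w; rewrite /=; tauto.
- move=> i B GB; have mB := Gm GB.
  rewrite set_integral_setUI//.
  have -> : J (h i) (V `&` U `&` B) = J (h i \* \1_U) (V `&` B).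
    rewrite set_integral_mul_indic//; last exact: measurableI.
    by congr (J _ _); apply/seteqP; split => w /=; tauto.
  have i2 : integrable (fun w => 2 * (h i \* doubling k) w).
    exact: (integrableZl measurableT 2 (ihp i k)).
  have iU : integrable (h i \* \1_U) by exact: integrable_mul_indic.
  have -> : J (h i \* doubling k.+1) ((R0 `\` V) `&` B) =
     J ((fun w => 2 * (h i \* doubling k) w) \- (h i \* \1_U)) ((R0 `\` V) `&` B).
    by apply: eq_set_integral => w _ /=; rewrite -/U; lra.
  have mRVB : measurable ((R0 `\` V) `&` B) by exact: measurableI.
  rewrite set_integralB// (set_integralZ 2 (ihp i k) mRVB).
  rewrite !set_integral_setDI//.
  have := SJ i B GB.
  have := VP _ (or_intror (imageT F (inr (inl i)))) B GB.
  have := VP _ (or_intror (imageT F (inr (inr i)))) B GB => /=.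
  lra.
- have := VP _ (or_introl erefl) setT (subG_setT Gsub); rewrite !setIT => V2.
  rewrite -(setIT (_ `\` _)) set_integral_setDI// !setIT exprS mulrA.
  by apply: le_trans SR0; rewrite ler_wpM2r ?exprn_ge0//; lra.
Qed.

(** [D] collects all accepted parts. Both the points accepted after stage [k] and the mass not yet
    distributed live on the undecided part, of measure at most [2 ^- k]. *)
Lemma split_integrable : exists2 D, measurable D &
  forall i B, G B -> J (h i) (D `&` B) = J (h i \* p) B.
Proof.
have [s [_ sP s_]] := dependent_choice_inv split0 split_step.
pose D := \bigcup_k (s k).2.
have ms k : measurable (s k).2 := split_mD (sP k).
have mR k : measurable (s k).1 := split_mR (sP k).
have mD : measurable D by exact: bigcup_measurable.
have sD k : (s k).2 `<=` D by move=> w ?; exists k.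
have nested k j : (s (k + j)%N).1 `|` (s (k + j)%N).2 `<=` (s k).1 `|` (s k).2.
  elim: j => [|j IH]; first by rewrite addn0.
  by rewrite addnS; apply: subset_trans IH; case: (s_ (k + j)%N).
have nd k j : (s k).2 `<=` (s (k + j)%N).2.
  elim: j => [|j IH]; first by rewrite addn0.
  by rewrite addnS; apply: subset_trans IH _; case: (s_ (k + j)%N).
have DR k : D `\` (s k).2 `<=` (s k).1.
  move=> w [[l _ Dlw] nDkw]; have [kl|lk] := leqP k l.
    have := nested k (l - k)%N w; rewrite subnKC// => /(_ (or_intror Dlw)).
    by rewrite /=; tauto.
  by case: nDkw; have := nd l (k - l)%N w; rewrite subnKC; [exact|exact: ltnW].
exists D => // i B GB; have mB := Gm GB.
apply/eqP; rewrite -subr_eq0 -normr_le0; apply/ler_addgt0Pr => e e0; rewrite add0r.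
have e20 : 0 < e / 2 by lra.
have [r r0 small] := set_integral_small (ih i) e20.
have [k kP] : exists k : nat, 1 / 2 ^+ k < r.
  apply: contrapT => H; have : r <= 0; last by rewrite leNgt r0.
  apply: (@le0_halves _ _ 1) => k; rewrite leNgt; apply/negP => H2.
  by apply: H; exists k.
have Rr : m (s k).1 < r.
  by apply: le_lt_trans kP; rewrite ler_pdivlMr ?exprn_gt0//; exact: split_R0 (sP k).
have JD2 : J (h i) (D `&` B) = J (h i) ((s k).2 `&` B) + J (h i) ((D `\` (s k).2) `&` B).
  rewrite (set_integral_setID (ih i) (measurableI _ _ mD mB) (ms k)).
  by congr (J _ _ + J _ _); apply/seteqP; split => w /=; have := sD k w; tauto.
have mDs : measurable (D `\` (s k).2) by exact: measurableD.
have sm f A : integrable f -> (forall w, `|f w| <= `|h i w|) ->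
    measurable A -> A `<=` (s k).1 -> `|J f (A `&` B)| < e / 2.
  move=> iF fh mA AR; apply: small => //; first exact: measurableI.
  apply: le_lt_trans Rr; apply: set_integral1_le => //; first exact: measurableI.
  by move=> w [/AR].
have := sm _ _ (ih i) (fun w => lexx _) mDs (DR k).
have : `|J (h i \* doubling k) ((s k).1 `&` B)| < e / 2.
  apply: sm => // w; rewrite /= normrM ler_piMr//.
  by rewrite ger0_norm; case/andP: (doubling01 k w).
have := split_J (sP k) i GB; rewrite JD2.
rewrite !ltr_norml ler_norml; lra.
Qed.

End integrable_weight.

End split_by_weight.

(** Replaces a mixture of [h1] and [h2] with weight [p] by a choice between them. The functions need
    not be integrable, which is why the integrals are extended reals, and the choice is exact at
    every point where [p] is 0 or 1, so that later no null section is ever selected. *)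
Lemma split_nonneg d (T : measurableType d) (R : realType) (mu : probability T R)
    (G : set (set T)) (I : finType) (h1 h2 : I -> T -> R) (p : T -> R) :
  is_sub_sigma_algebra G -> (forall D, ~ sub_atom mu G D) ->
  (forall i, measurable_fun [set: T] (h1 i)) ->
  (forall i, measurable_fun [set: T] (h2 i)) ->
  (forall i w, 0 <= h1 i w) -> (forall i w, 0 <= h2 i w) ->
  measurable_fun [set: T] p -> (forall w, 0 <= p w <= 1) ->
  exists D, [/\ measurable D, [set w | p w = 1] `<=` D,
    D `&` [set w | p w = 0] `<=` set0 &
    forall i B, G B ->
      (\int[mu]_(w in B) (if w \in D then h1 i w else h2 i w)%:E =
       \int[mu]_(w in B) (p w * h1 i w + (1 - p w) * h2 i w)%:E)%E].
Proof.
move=> Gsub noatom mh1 mh2 h1_ge0 h2_ge0 mp p01.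
pose s w := \sum_i (h1 i w + h2 i w).
have ms : measurable_fun [set: T] s.
  by apply: measurable_sum => i; exact: measurable_funD.
have hs i w : h1 i w <= s w /\ h2 i w <= s w.
  rewrite /s (bigD1 i)//=.
  have : 0 <= \sum_(j | j != i) (h1 j w + h2 j w).
    by apply: sumr_ge0 => j _; rewrite addr_ge0.
  by have := h1_ge0 i w; have := h2_ge0 i w; lra.
have s_ge0 w : 0 <= s w by apply: sumr_ge0 => j _; rewrite addr_ge0.
pose p0 := p @^-1` [set 0]; pose p1 := p @^-1` [set 1].
have mp0 : measurable p0 by rewrite -[X in measurable X]setTI; exact: mp.
have mp1 : measurable p1 by rewrite -[X in measurable X]setTI; exact: mp.
(* On each [S j] all the functions are bounded, hence integrable. *)
pose S j := if j is j.+1 then ~` (p0 `|` p1) `&` (s @^-1` `[j%:R, j.+1%:R[) else p0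
  `|` p1.
have mS j : measurable (S j).
  case: j => [|j] /=; first exact: measurableU.
  apply: measurableI; first by apply: measurableC; exact: measurableU.
  by rewrite -[X in measurable X]setTI; exact: ms.
have tS : trivIset [set: nat] S.
  move=> [|i] [|j] _ _ //= [w].
  - by move=> [? []].
  - by move=> [[]].
  - move=> [[_ /= si] [_ /= sj]]; move: si sj; rewrite !in_itv/=.
    move=> /andP[i1 i2] /andP[j1 j2].
    have := le_lt_trans i1 j2; have := le_lt_trans j1 i2.
    by rewrite !ltr_nat !ltnS => ij ji; congr _.+1; apply/eqP; rewrite eqn_leq ij ji.
have US : \bigcup_j S j = [set: T].
  apply/seteqP; split => // w _.
  have [?|?] := EM ((p0 `|` p1) w); first by exists 0%N.
  exists (Num.truncn (s w)).+1 => //=; split => //.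
  by rewrite /= in_itv/= truncn_itv.
(* The slices need not belong to [G], so their indicators are multiplied into the integrands instead
   of being intersected with [B]. *)
pose F j (x : I + I) :=
  match x with inl i => h1 i \* \1_(S j) | inr i => h2 i \* \1_(S j) end.
have bounded_int j (f : T -> R) : (forall w, `|f w| <= s w) ->
    measurable_fun [set: T] f -> mu.-integrable [set: T] (EFin \o (f \* \1_(S j.+1))).
  move=> fs mf; apply: (integrable_bound (h := cst j.+1%:R)).
  - exact: finite_measure_integrable_cst.
  - by apply: measurable_funM => //; exact: measurable_indic.
  move=> w /=; rewrite indicE; have [/set_mem|_] := boolP (_ \in _).
    rewrite mulr1 /S/= in_itv/= => -[_ /andP[_ /ltW sw]].
    by apply: le_trans (fs w) _; rewrite [leRHS]ger0_norm.
  by rewrite mulr0 normr0.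
have iF j x : mu.-integrable [set: T] (EFin \o F j.+1 x).
  case: x => i; apply: bounded_int => // w.
    by rewrite ger0_norm//; exact: (hs i w).1.
  by rewrite ger0_norm//; exact: (hs i w).2.
have /choice[D DP] : forall j, exists D, measurable D /\
    forall x B, G B -> set_integral mu (F j.+1 x) (D `&` B) = set_integral mu (F j.+1
      x \* p) B.
  by move=> j; have [D mD DP] := split_integrable Gsub noatom (iF j) mp p01; exists D.
(* On [S 0] the value of [p] forces the choice; [D j] decides on [S j.+1]. *)
pose D' := p1 `|` \bigcup_j (D j `&` S j.+1).
have mD j : measurable (D j) := (DP j).1.
have mD' : measurable D'.
  by apply: measurableU => //; apply: bigcup_measurable => j _; exact: measurableI.
have D'S j w : S j.+1 w -> (w \in D') = (w \in D j).
  move=> Sw; apply/idP/idP => /set_mem H; apply/mem_set.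
    case: H => [p1w|[l _ [Dw Slw]]]; first by case: Sw => + _ => /(_ (or_intror p1w)).
    have /succn_inj <- // : l.+1 = j.+1 by apply: tS => //; exists w.
  by right; exists j.
have mif i : measurable_fun [set: T] (fun w => if w \in D' then h1 i w else h2 i w).
  rewrite (_ : (fun w => _) = (\1_D' \* h1 i) \+ ((cst 1 \- \1_D') \* h2 i)).
    apply: measurable_funD; apply: measurable_funM => //.
    exact: measurable_funB.
  apply/funext => w /=; rewrite indicE.
  by case: (w \in D') => /=; rewrite ?subrr ?mul1r ?mul0r ?addr0// add0r subr0 mul1r.
have mmix i : measurable_fun [set: T] (fun w => p w * h1 i w + (1 - p w) * h2 i w).
  apply: measurable_funD; apply: measurable_funM => //.
  exact: measurable_funB.
exists D'; split => //.
- by move=> w p1w; left.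
- move=> w [[/= -> /eqP|[j _ [_ [+ _]]] pw]]; first by rewrite oner_eq0.
  by apply; left.
move=> i B GB; have mB := subG_measurable Gsub GB.
have mBS j : measurable (B `&` S j) by exact: measurableI.
rewrite -(setIT B) -US setI_bigcupr !ge0_integral_bigcup//; last first.
- exact: trivIset_setIl.
- by move=> w _; rewrite lee_fin; case: ifP.
- by apply: measurable_funTS; exact/measurable_EFinP.
- exact: trivIset_setIl.
- by move=> w _; rewrite lee_fin; case/andP: (p01 w) => *;
  rewrite addr_ge0 ?mulr_ge0 ?subr_ge0.
- by apply: measurable_funTS; exact/measurable_EFinP.
apply: eq_eseriesr => j _.
case: j => [|j].
  apply: eq_integral => w /set_mem[_ /= [p0w|p1w]].
    rewrite p0w mul0r add0r subr0 mul1r; case: ifPn => // /set_mem[|[j _ [_ [+ _]]]].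
      by rewrite /p1/= p0w => /esym/eqP; rewrite oner_eq0.
    by case; left.
  rewrite p1w mul1r subrr mul0r addr0 mem_set//; left; exact: p1w.
(* [u] is the choice and [v] the mixture on the slice, both written as products so that linearity
   reduces their comparison to the defining property of [D j]. *)
pose u := (h1 i \* \1_(S j.+1)) \* \1_(D j) \+ (h2 i \* \1_(S j.+1)) \- (h2 i \*
  \1_(S j.+1)) \* \1_(D j).
pose v := (h1 i \* \1_(S j.+1)) \* p \+ (h2 i \* \1_(S j.+1)) \- (h2 i \* \1_(S
  j.+1)) \* p.
have i1 := iF j (inl i); have i2 := iF j (inr i); rewrite /F in i1 i2.
have i1D := integrable_mul_indic i1 (mD j).
have i2D := integrable_mul_indic i2 (mD j).
have pn w : `|p w| <= 1 by rewrite ger0_norm; case/andP: (p01 w).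
have i1p := integrable_mul i1 mp pn.
have i2p := integrable_mul i2 mp pn.
have iu : mu.-integrable [set: T] (EFin \o u).
  exact: (integrableB measurableT (integrableD measurableT i1D i2) i2D).
have iv : mu.-integrable [set: T] (EFin \o v).
  exact: (integrableB measurableT (integrableD measurableT i1p i2) i2p).
rewrite !(setIC B) !integral_mkcondl.
transitivity ((set_integral mu u B)%:E).
  rewrite /set_integral /Rintegral fineK; last first.
    by apply: integrable_fin_num => //; exact: integrableS iu.
  apply: eq_integral => w _; rewrite patchE /u/= !indicE.
  case: ifPn => [/set_mem Sw|_]; rewrite ?(D'S _ _ Sw); last first.
    by rewrite !mulr0 !mul0r addr0 subr0.
  by case: (w \in D j) => /=; congr EFin; lra.
transitivity ((set_integral mu v B)%:E).
  congr EFin.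
  rewrite /u /v set_integralB//; last exact: (integrableD measurableT i1D i2).
  rewrite set_integralD// [RHS]set_integralB//;
    last exact: (integrableD measurableT i1p i2).
  rewrite set_integralD// (set_integral_mul_indic i1 (mD j) mB)
    (set_integral_mul_indic i2 (mD j) mB).
  have e1 : set_integral mu (h1 i \* \1_(S j.+1)) (D j `&` B) =
    set_integral mu (h1 i \* \1_(S j.+1) \* p) B := (DP j).2 (inl i) _ GB.
  have e2 : set_integral mu (h2 i \* \1_(S j.+1)) (D j `&` B) =
    set_integral mu (h2 i \* \1_(S j.+1) \* p) B := (DP j).2 (inr i) _ GB.
  by rewrite e1 e2.
rewrite /set_integral /Rintegral fineK; last first.
  by apply: integrable_fin_num => //; exact: integrableS iv.
apply: eq_integral => w _; rewrite patchE /v/= !indicE.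
case: ifPn => [/set_mem Sw|_]; last by rewrite !mulr0 !mul0r addr0 subr0.
by congr EFin; rewrite !mulr1; ring.
Qed.

(** * Fiberwise averages and refinements *)

Section fiber_average.
Context d (T : measurableType d) d' (Y : measurableType d') (R : realType).
Context (k : R.-pker T ~> Y).
Implicit Types (q r : T * Y -> R) (A C E : set (T * Y)).

Definition fiber_integral q (w : T) : R := \int[k w]_x q (w, x).
Local Notation fint := fiber_integral.

(** Integrability is required for every [w], not almost every one, so that the real integral over
    each fiber agrees with the extended one; see [fiber_integralE]. *)
Definition fiber_integrable q : Prop := [/\ measurable_fun [set: T * Y] q,
  forall z, 0 <= q z & forall w, (k w).-integrable [set: Y] (EFin \o (fun x => q (w,
    x)))].

(* The average of [q (w, .)] under [k w] conditioned on the section of [E];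
   it is 0 when this section is null. *)
Definition fiber_average E q (w : T) : R := fint (q \* \1_E) w / fint \1_E w.
Local Notation avg := fiber_average.

Lemma measurable_fiber q w : measurable_fun [set: T * Y] q ->
  measurable_fun [set: Y] (fun x => q (w, x)).
Proof. by move=> mq; exact: measurableT_comp. Qed.

Lemma fiber_integrable_le q r : fiber_integrable r -> measurable_fun [set: T * Y] q ->
  (forall z, 0 <= q z <= r z) -> fiber_integrable q.
Proof.
move=> [mr r0 ir] mq qr; split => // [z|w]; first by case/andP: (qr z).
apply: le_integrable (ir w) => //.
  by apply/measurable_EFinP; exact: measurable_fiber.
move=> x _ /=; rewrite lee_fin; case/andP: (qr (w, x)) => q0 qr'.
by rewrite !ger0_norm.
Qed.

Lemma fiber_integrable_cst (c : R) : 0 <= c -> fiber_integrable (cst c).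
Proof.
move=> c0; split => // w.
apply/integrableP; split; first exact/measurable_EFinP.
rewrite (eq_integral (cst c%:E)); last by move=> x _ /=; rewrite ger0_norm.
by rewrite integral_cst// prob_kernel mule1 ltry.
Qed.

Lemma fiber_integrableD q r : fiber_integrable q -> fiber_integrable r ->
  fiber_integrable (q \+ r).
Proof.
move=> [mq q0 iq] [mr r0 ir]; split => [|z|w]; first exact: measurable_funD.
  by rewrite addr_ge0.
exact: (integrableD measurableT (iq w) (ir w)).
Qed.

Lemma fiber_integrable_sum (I : Type) (s : seq I) (q : I -> T * Y -> R) :
  (forall i, fiber_integrable (q i)) -> fiber_integrable (fun z => \sum_(i <- s) q i z).
Proof.
move=> iq; elim: s => [|i s IH].
  rewrite (_ : (fun z => _) = cst 0); first exact: fiber_integrable_cst.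
  by apply/funext => z; rewrite big_nil.
rewrite (_ : (fun z => _) = q i \+ (fun z => \sum_(i <- s) q i z)).
  exact: fiber_integrableD.
by apply/funext => z; rewrite big_cons.
Qed.

Lemma fiber_integrable_indic q A : fiber_integrable q -> measurable A ->
  fiber_integrable (q \* \1_A).
Proof.
move=> gq mA; apply: fiber_integrable_le (gq) _ _.
  by apply: measurable_funM => //; case: gq.
move=> z; have q0 : 0 <= q z by case: gq.
by rewrite /= indicE; case: (_ \in _); rewrite ?mulr1 ?mulr0 q0 lexx.
Qed.

Lemma fiber_integrable_indic1 A : measurable A -> fiber_integrable \1_A.
Proof.
move=> mA; apply: (fiber_integrable_le (r := cst 1)) => //.
  exact: fiber_integrable_cst.
by move=> z; rewrite indicE; case: (_ \in _); rewrite ?lexx ler01.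
Qed.

Lemma fiber_integralE q w : fiber_integrable q ->
  (fint q w)%:E = (\int[k w]_x (q (w, x))%:E)%E.
Proof.
by move=> [mq q0 iq]; rewrite /fint /Rintegral fineK//; exact: integrable_fin_num.
Qed.

Lemma fiber_integral_ge0 q w : (forall z, 0 <= q z) -> 0 <= fint q w.
Proof. by move=> q0; apply: Rintegral_ge0. Qed.

Lemma fiber_integralD q r w : fiber_integrable q -> fiber_integrable r ->
  fint (q \+ r) w = fint q w + fint r w.
Proof. by move=> [_ _ iq] [_ _ ir]; exact: RintegralD. Qed.

Lemma fiber_integral_le q r w : fiber_integrable q -> fiber_integrable r ->
  (forall x, q (w, x) <= r (w, x)) -> fint q w <= fint r w.
Proof. by move=> [_ _ iq] [_ _ ir] qr; apply: le_Rintegral. Qed.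

Lemma eq_fiber_integral q r w : (forall x, q (w, x) = r (w, x)) -> fint q w = fint r w.
Proof. by move=> qr; apply: eq_Rintegral => x _; exact: qr. Qed.

Lemma fiber_integral_cst (c : R) w : fint (cst c) w = c.
Proof.
by rewrite /fint Rintegral_cst// prob_kernel mulr1.
Qed.

Lemma fiber_integral_sum (I : Type) (s : seq I) (q : I -> T * Y -> R) w :
  (forall i, fiber_integrable (q i)) ->
  fint (fun z => \sum_(i <- s) q i z) w = \sum_(i <- s) fint (q i) w.
Proof.
move=> iq; elim: s => [|i s IH].
  rewrite big_nil -[RHS](fiber_integral_cst 0 w); apply: eq_fiber_integral => x.
  by rewrite big_nil.
rewrite big_cons -IH -fiber_integralD//; last exact: fiber_integrable_sum.
by apply: eq_fiber_integral => x /=; rewrite big_cons.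
Qed.

Lemma measurable_fiber_integral q : fiber_integrable q -> measurable_fun [set: T]
  (fint q).
Proof.
move=> gq; have [mq q0 iq] := gq; apply/measurable_EFinP.
rewrite (_ : EFin \o _ = fun w => \int[k w]_x (q (w, x))%:E)%E; last first.
  by apply/funext => w /=; rewrite fiber_integralE.
apply: (measurable_fun_integral_finite_kernel (EFin \o q) k) => //.
exact/measurable_EFinP.
Qed.

Lemma fiber_integral_setID q A C w : fiber_integrable q -> measurable A -> measurable C ->
  fint (q \* \1_A) w = fint (q \* \1_(A `&` C)) w + fint (q \* \1_(A `\` C)) w.
Proof.
move=> gq mA mC; rewrite -fiber_integralD; last 2 first.
- by apply: fiber_integrable_indic => //; exact: measurableI.
- by apply: fiber_integrable_indic => //; exact: measurableD.
apply: eq_fiber_integral => x /=; rewrite !indicE in_setD in_setI.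
by case: (_ \in A); case: (_ \in C); rewrite /= ?mulr1 ?mulr0 ?addr0 ?add0r.
Qed.

(** A null section contributes nothing, whatever the integrand. This reconciles the value 0 of an
    average over a null section with the decomposition of integrals. *)
Lemma fiber_integral_null q A w : fiber_integrable q -> measurable A ->
  fint \1_A w = 0 -> fint (q \* \1_A) w = 0.
Proof.
move=> gq mA A0; have [mq q0 iq] := gq.
apply: EFin_inj; rewrite fiber_integralE; last exact: fiber_integrable_indic.
have mAw : measurable [set x | A (w, x)].
  have := measurable_xsection w mA; rewrite /xsection.
  by congr measurable; apply/seteqP; split => x /=; rewrite inE.
have indE x : \1_A (w, x) = \1_[set x | A (w, x)] x :> R by rewrite !indicE;
  congr (_%:R); apply/idP/idP; rewrite !inE.
have kA : k w [set x | A (w, x)] = 0%E.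
  have := fiber_integralE w (fiber_integrable_indic1 mA); rewrite A0.
  under eq_integral do rewrite indE.
  by rewrite integral_indic// setIT => <-.
rewrite (_ : (fun x => _) = (EFin \o (fun x => q (w, x))) \_ [set x | A (w, x)]);
  last first.
  apply/funext => x; rewrite patchE/= indE indicE.
  by case: ifPn; rewrite ?mulr1 ?mulr0.
rewrite -integral_mkcond; apply: null_set_integral => //.
by apply: measurable_funTS; exact: measurable_int (iq w).
Qed.

Lemma fiber_average_ge0 E q w : (forall z, 0 <= q z) -> 0 <= avg E q w.
Proof.
move=> q0; rewrite divr_ge0// fiber_integral_ge0// => z.
  by rewrite mulr_ge0.
Qed.

Lemma measurable_fiber_average E q : fiber_integrable q -> measurable E ->
  measurable_fun [set: T] (avg E q).
Proof.
move=> gq mE.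
have m1 := measurable_fiber_integral (fiber_integrable_indic gq mE).
have m2 := measurable_fiber_integral (fiber_integrable_indic1 mE).
apply: measurable_funM => //.
(* The inverse is written as a real power, whose measurability is known; this is legitimate because
   the base is nonnegative. *)
rewrite (_ : (fun w => _) = (fun w => fint \1_E w `^ -1)); last first.
  by apply/funext => w; rewrite powR_inv1// fiber_integral_ge0// => z; rewrite indicE.
exact: (measurableT_comp (measurable_powR _) m2).
Qed.

End fiber_average.

(** * Cutting a set fiberwise without changing the averages over the sub-sigma-algebra *)

Section refinement.
Context d (T : measurableType d) (R : realType) (mu : probability T R).
Context (G : set (set T)) (Gsub : is_sub_sigma_algebra G).
Context (noatom : forall D, ~ sub_atom mu G D).
Context d' (Y : measurableType d') (k : R.-pker T ~> Y).
Implicit Types (q r : T * Y -> R) (A C E : set (T * Y)).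

Local Notation fint := (fiber_integral k).
Local Notation avg := (fiber_average k).
Local Notation good := (fiber_integrable k).

(** Positivity is asked for every [w]: averages are then genuine conditional means, and every
    section contains a point. *)
Definition charged E : Prop := measurable E /\ forall w, 0 < fint \1_E w.

Lemma charged_setT : charged setT.
Proof.
split => // w; rewrite (eq_fiber_integral k (r := cst 1)); last by move=> x;
  rewrite indicT.
by rewrite fiber_integral_cst.
Qed.

Lemma fiber_average_le E q r w : good q -> good r -> measurable E ->
  (forall z, q z <= r z) -> avg E q w <= avg E r w.
Proof.
move=> gq gr mE qr; apply: ler_wpM2r.
  by rewrite invr_ge0 fiber_integral_ge0// => z; rewrite indicE.
apply: fiber_integral_le; [exact: fiber_integrable_indic|exact: fiber_integrable_indic|].
by move=> x /=; rewrite ler_wpM2r// indicE.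
Qed.

Lemma fiber_averageD E q r w : good q -> good r -> measurable E ->
  avg E (q \+ r) w = avg E q w + avg E r w.
Proof.
move=> gq gr mE; rewrite /fiber_average -mulrDl; congr (_ / _).
rewrite -fiber_integralD; [|exact: fiber_integrable_indic|exact: fiber_integrable_indic].
by apply: eq_fiber_integral => x /=; rewrite mulrDl.
Qed.

Lemma fiber_average_sum (I : Type) (s : seq I) E (q : I -> T * Y -> R) w :
  (forall i, good (q i)) -> measurable E ->
  avg E (fun z => \sum_(i <- s) q i z) w = \sum_(i <- s) avg E (q i) w.
Proof.
move=> gq mE; rewrite /fiber_average -mulr_suml; congr (_ / _).
rewrite -fiber_integral_sum; last by move=> i; exact: fiber_integrable_indic.
by apply: eq_fiber_integral => x /=; rewrite mulr_suml.
Qed.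

Lemma fiber_average_cst E (c : R) w : charged E -> avg E (cst c) w = c.
Proof.
move=> [mE E0]; rewrite /fiber_average.
have -> : fint (cst c \* \1_E) w = c * fint \1_E w.
  have [_ _ iE] := fiber_integrable_indic1 k mE.
  by rewrite /fiber_integral -RintegralZl.
by rewrite mulfK// gt_eqF.
Qed.

(** The average over [E] is the mixture of the averages over the parts inside and outside [C], with
    weight [p] the conditional probability of [C]. [split_nonneg] turns this mixture into a choice
    of one of the two parts for each [w]. *)
Lemma charged_split (I : finType) (q : I -> T * Y -> R) E C :
  (forall i, good (q i)) -> charged E -> measurable C ->
  exists E', [/\ charged E', E' `<=` E,
    forall w, (forall x, E' (w, x) -> C (w, x)) \/ (forall x, E' (w, x) -> ~ C (w, x)) &
    forall i B, G B -> (\int[mu]_(w in B) (avg E' (q i) w)%:E =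
                        \int[mu]_(w in B) (avg E (q i) w)%:E)%E].
Proof.
move=> gq [mE E0] mC.
have q0 i z : 0 <= q i z by case: (gq i).
have mEC : measurable (E `&` C) by exact: measurableI.
have mED : measurable (E `\` C) by exact: measurableD.
have ind0 A z : 0 <= \1_A z :> R by rewrite indicE.
have massE w : fint \1_E w = fint \1_(E `&` C) w + fint \1_(E `\` C) w.
  have := fiber_integral_setID w (fiber_integrable_cst k ler01) mE mC.
  have mul1 A : fint (cst 1 \* \1_A) w = fint \1_A w.
    by apply: eq_fiber_integral => x; rewrite /= mul1r.
  by rewrite !mul1.
have EC0 w : 0 <= fint \1_(E `&` C) w by exact: fiber_integral_ge0.
have ED0 w : 0 <= fint \1_(E `\` C) w by exact: fiber_integral_ge0.
pose p w := fint \1_(E `&` C) w / fint \1_E w.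
have pE w : p w = avg E \1_C w.
  congr (_ / _); apply: eq_fiber_integral => x /=.
  by rewrite !indicE in_setI; case: (_ \in E); case: (_ \in C); rewrite ?mulr1 ?mulr0.
have mp : measurable_fun [set: T] p.
  rewrite (_ : p = avg E \1_C); last exact/funext.
  by apply: measurable_fiber_average => //; exact: fiber_integrable_indic1.
have p01 w : 0 <= p w <= 1.
  by rewrite divr_ge0 ?(ltW (E0 w))//= ler_pdivrMr// mul1r massE lerDl.
have [D [mD D1 D0 DP]] := split_nonneg (mu := mu) Gsub noatom
  (fun i => measurable_fiber_average (gq i) mEC)
  (fun i => measurable_fiber_average (gq i) mED)
  (fun i w => fiber_average_ge0 k _ w (q0 i))
  (fun i w => fiber_average_ge0 k _ w (q0 i)) mp p01.
pose E' := (D `*` [set: Y]) `&` (E `&` C) `|` ((~` D) `*` [set: Y]) `&` (E `\` C).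
have mE' : measurable E'.
  apply: measurableU; apply: measurableI => //; apply: measurableX => //.
  exact: measurableC.
have fE' q' w : fint (q' \* \1_E') w =
    if w \in D then fint (q' \* \1_(E `&` C)) w else fint (q' \* \1_(E `\` C)) w.
  case: ifPn => [/set_mem Dw|/negP Dw]; apply: eq_fiber_integral => x /=;
    rewrite !indicE; congr (_ * (nat_of_bool _)%:R); apply/idP/idP; rewrite !inE /E'/=.
  - tauto.
  - tauto.
  - by rewrite inE in Dw; tauto.
  - by rewrite inE in Dw; tauto.
have m1E' w : fint \1_E' w = if w \in D then fint \1_(E `&` C) w else fint \1_(E `\` C) w.
  have mul1 A : fint \1_A w = fint (cst 1 \* \1_A) w.
    by apply: eq_fiber_integral => x; rewrite /= mul1r.
  by rewrite !mul1 fE'.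
have avgE' i w : avg E' (q i) w = if w \in D then avg (E `&` C) (q i) w else avg (E
  `\` C) (q i) w.
  by rewrite /fiber_average fE' m1E'; case: ifP.
exists E'; split.
(* A null part is never chosen: the part inside [C] is null only if [p] is 0, the part outside only
   if [p] is 1, and there [D] makes the opposite choice. *)
- split => // w; rewrite m1E' lt_neqAle; case: ifPn => [/set_mem Dw|Dw];
  rewrite ?EC0 ?ED0 andbT.
    apply/eqP => e0; apply: (D0 w); split => //=.
    by rewrite /p -e0 mul0r.
  apply: contraNN Dw => /eqP e0; apply/mem_set/D1 => /=.
  by rewrite /p massE -e0 addr0 divff//; have := E0 w;
    rewrite massE -e0 addr0 => /gt_eqF ->.
- by move=> z [[_ []]|[_ []]].
- move=> w; have [Dw|Dw] := EM (D w); [left|right] => x [[[]]|[[]]]/=; tauto.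
- move=> i B GB; under eq_integral do rewrite avgE'.
  rewrite DP//; apply: eq_integral => w _; congr EFin.
  rewrite /p /fiber_average (fiber_integral_setID w (gq i) mE mC).
  have nE : fint \1_E w != 0 by rewrite gt_eqF.
  have -> : 1 - fint \1_(E `&` C) w / fint \1_E w = fint \1_(E `\` C) w / fint \1_E w.
    by apply: (mulIf nE); rewrite mulrBl mul1r !divfK// massE addrAC subrr add0r.
  rewrite mulrDl; congr (_ + _).
    (* Cancelling the mass of the part needs it to be nonzero; if it is zero, both sides vanish. *)
    have [e0|e0] := eqVneq (fint \1_(E `&` C) w) 0; last by field; rewrite nE.
    by rewrite (fiber_integral_null (gq i) mEC e0) !mul0r mulr0.
  have [e0|e0] := eqVneq (fint \1_(E `\` C) w) 0; last by field; rewrite nE.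
  by rewrite (fiber_integral_null (gq i) mED e0) !mul0r mulr0.
Qed.

Lemma charged_multisplit (I : finType) (q : I -> T * Y -> R) E (C : nat -> set (T *
  Y)) n :
  (forall i, good (q i)) -> charged E -> (forall j, measurable (C j)) ->
  exists E', [/\ charged E', E' `<=` E,
    forall j w, (j < n)%N -> (forall x, E' (w, x) -> C j (w, x)) \/
                       (forall x, E' (w, x) -> ~ C j (w, x)) &
    forall i B, G B -> (\int[mu]_(w in B) (avg E' (q i) w)%:E =
                        \int[mu]_(w in B) (avg E (q i) w)%:E)%E].
Proof.
move=> gq cE mC; elim: n => [|n [E1 [cE1 E1E E1C E1q]]].
  by exists E; split.
have [E2 [cE2 E21 E2C E2q]] := charged_split gq cE1 (mC n).
exists E2; split => // [|j w|i B GB]; first exact: subset_trans E1E.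
  rewrite ltnS leq_eqVlt => /predU1P[->//|jn].
  by case: (E1C j w jn) => H; [left|right] => x /E21; exact: H.
by rewrite E2q// E1q.
Qed.

End refinement.

Lemma indic_bigcap_cvg (Z : Type) (R : realType) (A : nat -> set Z) z :
  (forall n, A n.+1 `<=` A n) ->
  (\1_(A n) z : R) @[n --> \oo] --> (\1_(\bigcap_n A n) z : R).
Proof.
move=> Adecr.
have decr n j : A (n + j)%N z -> A n z.
  by elim: j => [|j IH]; rewrite ?addn0// addnS => /Adecr.
have [zA|] := EM ((\bigcap_n A n) z).
  rewrite (_ : (fun n => _) = cst (\1_(\bigcap_n A n) z)); first exact: cvg_cst.
  by apply/funext => n; rewrite !indicE !mem_set//; exact: zA.
move=> nzA; have [n nAn] : exists n, ~ A n z.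
  by apply: contrapT => H; apply: nzA => n _; apply: contrapT => nA; apply: H; exists n.
apply: cvg_near_cst; exists n => // j /= nj.
rewrite !indicE !memNset//.
by move=> Ajz; apply: nAn; apply: (decr n (j - n)%N); rewrite subnKC.
Qed.

(** * One stage of refinement along a countable cover *)

Section refinement_stage.
Context d (T : measurableType d) (R : realType) (mu : probability T R).
Context (G : set (set T)) (Gsub : is_sub_sigma_algebra G).
Context (noatom : forall D, ~ sub_atom mu G D).
Context d' (Y : measurableType d') (k : R.-pker T ~> Y).
Implicit Types (q r : T * Y -> R) (A C E : set (T * Y)).

Local Notation fint := (fiber_integral k).
Local Notation avg := (fiber_average k).
Local Notation good := (fiber_integrable k).

Lemma fiber_integral_cvg r (A : nat -> set (T * Y)) w : good r ->
  (forall n, measurable (A n)) -> (forall n, A n.+1 `<=` A n) ->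
  fint (r \* \1_(A n)) w @[n --> \oo] --> fint (r \* \1_(\bigcap_n A n)) w.
Proof.
move=> gr mA Adecr; have [mr r0 ir] := gr.
have mcap : measurable (\bigcap_n A n) by exact: bigcapT_measurable.
have gA n := fiber_integrable_indic gr (mA n).
have gcap := fiber_integrable_indic gr mcap.
have [|||||_ _ cv] := dominated_convergence (mu := k w) measurableT
    (f_ := fun n x => (r (w, x) * \1_(A n) (w, x))%:E)
    (f := fun x => (r (w, x) * \1_(\bigcap_n A n) (w, x))%:E)
    (g := fun x => (r (w, x))%:E).
- by move=> n; apply/measurable_EFinP; apply: (measurable_fiber w (q :=
  r \* \1_(A n))); case: (gA n).
- by apply/measurable_EFinP; apply: (measurable_fiber w (q :=
  r \* \1_(\bigcap_n A n))); case: gcap.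
- apply: aeW => x _; apply: cvg_EFin; first exact: nearW.
  by apply: cvgMr; exact: indic_bigcap_cvg.
- exact: ir.
- apply: aeW => x n _; rewrite lee_fin ger0_norm ?mulr_ge0//.
  by rewrite ler_piMr// indicE; case: (_ \in _).
have /fine_cvg : (fun n => \int[k w]_x (r (w, x) * \1_(A n) (w, x))%:E)%E @ \oo -->
    (fint (r \* \1_(\bigcap_n A n)) w)%:E by rewrite fiber_integralE.
exact.
Qed.

(** Finitely many cuts suffice: the part of [E] missed by the first [n] sets carries an average of
    [r] that tends to 0 in the mean, by dominated convergence. The summand 1 in [r] bounds the
    measure of [N], and the other summands bound the integrals of the averages over [N]. *)
Lemma charged_stage (I : finType) (q : I -> T * Y -> R) E (C : nat -> set (T * Y)) (e
  : R) :
  (forall i, good (q i)) -> charged k E ->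
  (forall i, \int[mu]_w (avg E (q i) w)%:E < +oo)%E ->
  (forall j, measurable (C j)) ->
  {ae mu, forall w, fint \1_(~` \bigcup_j C j) w = 0} -> 0 < e ->
  exists E' N, [/\ charged k E' /\ E' `<=` E, measurable N,
    forall w, ~ N w -> exists j, forall x, E' (w, x) -> C j (w, x),
    (\int[mu]_(w in N) (1 + \sum_i avg E' (q i) w)%:E <= e%:E)%E &
    forall i B, G B -> (\int[mu]_(w in B) (avg E' (q i) w)%:E =
                        \int[mu]_(w in B) (avg E (q i) w)%:E)%E].
Proof.
move=> gq cE iq mC nullC e0; have [mE E0] := cE.
have q0 i z : 0 <= q i z by case: (gq i).
pose r z : R := 1 + \sum_i q i z.
have gr : good r.
  by apply: fiber_integrableD; [exact: fiber_integrable_cst|exact: fiber_integrable_sum].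
have r0 z : 0 <= r z by case: gr.
have avgr E1 w : charged k E1 -> avg E1 r w = 1 + \sum_i avg E1 (q i) w.
  move=> [mE1 E10]; rewrite -(fiber_average_sum _ w gq mE1).
  rewrite -(fiber_average_cst (k := k) (E := E1) 1 w)//.
  rewrite -fiber_averageD//; first exact: fiber_integrable_cst.
  exact: fiber_integrable_sum.
(* The average of [r] over the part of [E] missed by [C 0, ..., C n.-1] is
   preserved too, which bounds the integral over [N]. *)
pose U n := ~` \bigcup_(j in `I_n) C j.
have mU n : measurable (U n).
  by apply: measurableC; apply: bigcup_measurable => j _.
have Udecr n : U n.+1 `<=` U n.
  by move=> z nz [j /= jn Cjz]; apply: nz; exists j => //=; exact: ltnW.
have capU : \bigcap_n U n = ~` \bigcup_j C j.
  apply/seteqP; split => z.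
    by move=> zU [j _ Cjz]; apply: (zU j.+1 Logic.I); exists j => //=.
  by move=> nz n _ [j _ Cjz]; apply: nz; exists j.
have grU n : good (r \* \1_(U n)) by exact: fiber_integrable_indic.
have ir : mu.-integrable [set: T] (EFin \o avg E r).
  apply/integrableP; split.
    by apply/measurable_EFinP; exact: measurable_fiber_average.
  rewrite (eq_integral (fun w => 1%:E + \sum_i (avg E (q i) w)%:E)%E); last first.
    move=> w _ /=; rewrite ger0_norm; last by apply: fiber_average_ge0; case: gr.
    by rewrite avgr// EFinD sumEFin.
  rewrite ge0_integralD//; last 2 first.
  - by move=> w _; apply: sume_ge0 => i _; rewrite lee_fin fiber_average_ge0.
  - by apply: emeasurable_sum => i; apply/measurable_EFinP;
    exact: measurable_fiber_average.
  rewrite integral_cst// mul1e ge0_integral_sum//; last 2 first.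
  - by move=> i; apply/measurable_EFinP; exact: measurable_fiber_average.
  - by move=> i w _; rewrite lee_fin fiber_average_ge0.
  rewrite lte_add_pinfty//;
    first exact: (le_lt_trans (probability_le1 mu measurableT) (ltry _)).
  by apply: lte_sum_pinfty => i _.
have [|||||_ _ cv] := dominated_convergence (mu := mu) measurableT
    (f_ := fun n w => (avg E (r \* \1_(U n)) w)%:E)
    (f := cst 0%E) (g := EFin \o avg E r).
- by move=> n; apply/measurable_EFinP; exact: measurable_fiber_average.
- exact: measurable_cst.
- apply: filterS nullC => w nullw _; apply: cvg_EFin; first exact: nearW.
  rewrite (_ : fine \o _ = fun n => fint ((r \* \1_E) \* \1_(U n)) w / fint \1_E w);
    last first.
    apply/funext => n /=; congr (_ / _); apply: eq_fiber_integral => x /=.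
    by rewrite mulrAC.
  rewrite -(mul0r (fint \1_E w)^-1); apply: cvgMl.
  rewrite -(fiber_integral_null (k := k) (q := r \* \1_E) (A :=
    ~` \bigcup_j C j) _ _ nullw).
  - by rewrite -capU; apply: fiber_integral_cvg => //; exact: fiber_integrable_indic.
  - exact: fiber_integrable_indic.
  - by apply: measurableC; exact: bigcup_measurable.
- exact: ir.
- apply: aeW => w n _; rewrite lee_fin ger0_norm; last by apply: fiber_average_ge0;
  case: (grU n).
  apply: fiber_average_le => // z; rewrite /= ler_piMr// indicE.
rewrite integral0 in cv.
have [n ne] : exists n, (\int[mu]_w (avg E (r \* \1_(U n)) w)%:E <= e%:E)%E.
  have [[n1 _ fin] cv0] := (fine_cvgP _ _).1 cv.
  have [n2 _ lt_e] := cvgr_lt _ cv0 _ e0.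
  exists (maxn n1 n2); rewrite -[leLHS]fineK; last by apply: fin; exact: leq_maxl.
  by rewrite lee_fin; apply/ltW/lt_e; exact: leq_maxr.
(* The additional payoff, indexed by [None], is the restriction of [r] to the uncovered part. *)
pose q' (x : option I) := if x is Some i then q i else r \* \1_(U n).
have gq' x : good (q' x) by case: x => [i|]; [exact: gq|exact: grU].
have [E' [cE' E'E E'C E'q]] := charged_multisplit (mu := mu) Gsub noatom n gq' cE mC.
have [mE' E'0] := cE'.
pose V := \bigcup_(j in `I_n) C j.
have mV : measurable V by apply: bigcup_measurable => j _.
have mE'V : measurable (E' `&` V) by exact: measurableI.
(* For [w] in [N] the section of [E'] misses the first [n] sets altogether, since lying inside one
   of them would give it positive mass in [V]. There the average of [r] over [E'] is thus that of
   the additional payoff. *)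
pose N := fint \1_(E' `&` V) @^-1` [set 0].
have mN : measurable N.
  rewrite -[N]setTI.
  by apply: (measurable_fiber_integral (fiber_integrable_indic1 k mE'V)).
have E'V w : (exists2 j, (j < n)%N & forall x, E' (w, x) -> C j (w, x)) \/
    (forall x, E' (w, x) -> ~ V (w, x)).
  have [H|H] := EM (exists2 j, (j < n)%N & forall x, E' (w, x) -> C j (w, x));
    first by left.
  right => x E'x [j /= jn Cj]; case: (E'C j w jn) => H2; last exact: H2 Cj.
  by apply: H; exists j.
exists E', N; split => //.
- move=> w Nw; case: (E'V w) => [[j _ ?]|H]; first by exists j.
  exfalso; apply: Nw; rewrite /N/=.
  rewrite (eq_fiber_integral k (r := cst 0)) ?fiber_integral_cst// => x.
  by rewrite indicE memNset// => -[/H].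
- have avgN w : N w -> 1 + \sum_i avg E' (q i) w = avg E' (r \* \1_(U n)) w.
    move=> Nw; rewrite -avgr//; congr (_ / _); apply: eq_fiber_integral => x /=.
    case: (E'V w) => [[j jn E'Cj]|H].
      have := E'0 w; rewrite (eq_fiber_integral k (r := \1_(E' `&` V))) ?Nw ?ltxx// => y.
      rewrite !indicE in_setI; have [/set_mem E'y|] := boolP (_ \in E'); last by [].
      by rewrite mem_set//; exists j => //; exact: E'Cj.
    rewrite !indicE; have [/set_mem E'x|_] := boolP (_ \in E'); last by rewrite !mulr0.
    by rewrite mem_set ?mulr1//; exact: H.
  rewrite (eq_integral (fun w => (avg E' (r \* \1_(U n)) w)%:E)); last first.
    by move=> w /set_mem Nw; rewrite avgN.
  apply: le_trans ne; rewrite -(E'q None _ (subG_setT Gsub)).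
  apply: ge0_subset_integral => //.
    by apply/measurable_EFinP; exact: measurable_fiber_average.
  by move=> w _; rewrite lee_fin fiber_average_ge0// => z; case: (grU n).
- by move=> i B GB; exact: (E'q (Some i)).
Qed.

End refinement_stage.

(** * Closed sections and small oscillation *)

Section closed_section_approximation.
Context d (T : measurableType d) (R : realType) (X : completeMetricType R).
Context (M : probability (T * borel X)%type R).
Implicit Types (A C S : set (T * borel X)).

Local Notation m := (set_integral M (cst 1)).
Let i1 := integrable_cst1 M.

(** Closedness is only imposed fiberwise, [T] having no topology; it keeps the limit point of a
    fiber inside the section. *)
Definition closed_sections S : Prop := forall w, @closed X [set x | S (w, x)].

(** Inner regularity for [M] with respect to measurable sets with closed sections. *)
Definition inner_closed S : Prop := forall e, 0 < e ->
  exists C, [/\ measurable C, closed_sections C, C `<=` S & m (S `\` C) < e].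

Let mU A C : measurable A -> measurable C -> m (A `|` C) <= m A + m C.
Proof.
move=> mA mC; have mCA : measurable (C `\` A) by exact: measurableD.
have -> : A `|` C = A `|` (C `\` A).
  by apply/seteqP; split => z /=; have := EM (A z); tauto.
rewrite set_integral_setU//; last by move=> w [? [_]].
by rewrite lerD2l; apply: set_integral1_le.
Qed.

Let m_sub A C : A `<=` C -> measurable A -> measurable C -> m A <= m C.
Proof. by move=> AC mA mC; exact: set_integral1_le. Qed.

Let m0 : m set0 = 0.
Proof. by rewrite /set_integral Rintegral_set0. Qed.

Lemma inner_closed_closed S : measurable S -> closed_sections S -> inner_closed S.
Proof. by move=> mS cS e e0; exists S; split => //; rewrite setDv m0. Qed.

Lemma inner_closedU A C : measurable A -> measurable C ->
  inner_closed A -> inner_closed C -> inner_closed (A `|` C).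
Proof.
move=> mA mC iA iC e e0; have e20 : 0 < e / 2 by lra.
have [A' [mA' cA' A'A eA]] := iA _ e20; have [C' [mC' cC' C'C eC]] := iC _ e20.
exists (A' `|` C'); split.
- exact: measurableU.
- by move=> w; have := closedU (cA' w) (cC' w).
- exact: setUSS.
- have : (A `|` C) `\` (A' `|` C') `<=` (A `\` A') `|` (C `\` C').
    by move=> z /=; tauto.
  move=> /m_sub H; apply: le_lt_trans (H _ _) _.
  + by apply: measurableD; exact: measurableU.
  + by apply: measurableU; exact: measurableD.
  apply: le_lt_trans (mU _ _) _; [exact: measurableD|exact: measurableD|lra].
Qed.

(** A countable union of closed sections need not be closed, so the union is first truncated to a
    finite one at the cost of [e / 2]. *)
Lemma inner_closed_bigcup (S : nat -> set (T * borel X)) :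
  (forall n, measurable (S n)) -> (forall n, inner_closed (S n)) ->
  inner_closed (\bigcup_n S n).
Proof.
move=> mS iS e e0; have e20 : 0 < e / 2 by lra.
pose V n := \big[setU/set0]_(j < n) S j.
have mV n : measurable (V n) by exact: bigsetU_measurable.
have iV n : inner_closed (V n).
  elim: n => [|n IH].
    rewrite /V big_ord0; apply: inner_closed_closed => //.
    by move=> w; exact: closed0.
  by rewrite /V big_ord_recr; apply: inner_closedU => //; exact: mV.
have VS : \bigcup_n V n = \bigcup_n S n.
  apply/seteqP; split => z [n _]; first by rewrite /V -bigcup_mkord => -[j _ ?]; exists j.
  by move=> Snz; exists n.+1 => //; rewrite /V big_ord_recr; right.
have [|n nP] := set_integral1_bigcup_small M mV _ e20.
  by move=> n; rewrite {2}/V big_ord_recr; exact: subsetUl.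
have [C [mC cC CV eC]] := iV n _ e20.
have mUS : measurable (\bigcup_n S n) by exact: bigcup_measurable.
exists C; split => //.
  by rewrite -VS; apply: subset_trans CV _; exact: bigcup_sup.
have : \bigcup_n S n `\` C `<=` (\bigcup_n S n `\` V n) `|` (V n `\` C).
  by move=> z /=; have := EM (V n z); tauto.
move=> /m_sub H; apply: le_lt_trans (H _ _) _.
- exact: measurableD.
- by apply: measurableU; exact: measurableD.
apply: le_lt_trans (mU _ _) _; [exact: measurableD|exact: measurableD|].
by rewrite VS in nP; lra.
Qed.

(** Intersections of closed sections are closed, so all approximations are intersected; the errors
    [e / 2 / 2 ^+ n.+1] are summable. *)
Lemma inner_closed_bigcap (S : nat -> set (T * borel X)) :
  (forall n, measurable (S n)) -> (forall n, inner_closed (S n)) ->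
  inner_closed (\bigcap_n S n).
Proof.
move=> mS iS e e0; have e20 : 0 < e / 2 by lra.
have /choice[C CP] : forall n, exists C, [/\ measurable C, closed_sections C, C `<=` S n &
    m (S n `\` C) < e / 2 / 2 ^+ n.+1].
  by move=> n; apply: iS; rewrite divr_gt0 ?exprn_gt0.
have mC n : measurable (C n) by case: (CP n).
have mcS : measurable (\bigcap_n S n) by exact: bigcapT_measurable.
have mcC : measurable (\bigcap_n C n) by exact: bigcapT_measurable.
pose F n := \big[setU/set0]_(j < n) (S j `\` C j).
have mF n : measurable (F n) by apply: bigsetU_measurable => j _; exact: measurableD.
(* The partial sums of the geometric series of errors. *)
have Fe n : m (F n) <= e / 2 * (1 - (2 ^+ n)^-1).
  elim: n => [|n IH]; first by rewrite /F big_ord0 m0 expr0 invr1 subrr mulr0.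
  rewrite /F big_ord_recr/=; apply: le_trans (mU _ _) _; [exact: mF|exact: measurableD|].
  have [_ _ _ /ltW Cn] := CP n; apply: le_trans (lerD IH Cn) _.
  rewrite exprS invfM; set t := (2 ^+ n)^-1; lra.
exists (\bigcap_n C n); split => //.
- move=> w; rewrite (_ : [set x | _] = \bigcap_n [set x : X | C n (w, x)])//.
  by apply: closed_bigI => n _; case: (CP n).
- by apply: subset_bigcap => n _; case: (CP n).
have [|n nP] := set_integral1_bigcup_small M mF _ e20.
  by move=> n; rewrite {2}/F big_ord_recr; exact: subsetUl.
have : \bigcap_n S n `\` \bigcap_n C n `<=` (\bigcup_n F n `\` F n) `|` F n.
  move=> z [Sz nCz]; have [?|nF] := EM (F n z); first by right.
  left; split => //; have [j nCj] : exists j, ~ C j z.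
    by apply: contrapT => H; apply: nCz => j _; apply: contrapT => H2; apply: H; exists j.
  exists j.+1 => //; rewrite /F big_ord_recr; right; split => //; exact: Sz.
have mUF : measurable (\bigcup_n F n) by exact: bigcup_measurable.
move=> /m_sub H; apply: le_lt_trans (H _ _) _.
- exact: measurableD.
- by apply: measurableU => //; exact: measurableD.
apply: le_lt_trans (mU _ _) _; [exact: measurableD|exact: mF|].
have : m (F n) <= e / 2.
  apply: le_trans (Fe n) _; apply: ler_piMr; first exact: ltW.
  by rewrite gerBl invr_ge0 exprn_ge0.
lra.
Qed.

(** Exhaust [U] by the points whose ball of radius [n.+1%:R^-1] stays in [U]. *)
Lemma open_Fsigma (U : set X) : open U ->
  exists F : nat -> set X, (forall n, closed (F n)) /\ \bigcup_n F n = U.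
Proof.
move=> oU; exists (fun n => [set x | ball x n.+1%:R^-1 `<=` U]); split.
  move=> n; rewrite -openC openE => x nFx.
  have [y xy nUy] : exists2 y, ball x n.+1%:R^-1 y & ~ U y.
    by apply: contrapT => H; apply: nFx => y xy; apply: contrapT => nUy; apply: H;
      exists y.
  rewrite ballEmdist/= in xy; have s0 : 0 < n.+1%:R^-1 - mdist x y by rewrite subr_gt0.
  apply: filterS (nbhsx_ballx x _ s0) => z; rewrite ballEmdist/= => xz.
  apply: contra_not nUy; apply; rewrite ballEmdist/=.
  by apply: le_lt_trans (metric_triangle _ x _) _; rewrite (metric_sym z x) -ltrBrDr.
apply/seteqP; split => [x [n _]|x Ux]; first by apply; exact: ballxx.
have /nbhs_ballP[e /= e0 eU] := open_nbhs_nbhs (conj oU Ux).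
exists (Num.truncn e^-1) => //; apply: subset_trans eU; apply: le_ball.
rewrite -[leRHS]invrK lef_pV2 ?posrE ?invr_gt0//; apply: ltW.
by have /truncn_itv/andP[] : 0 <= e^-1 by rewrite invr_ge0 ltW.
Qed.

Lemma measurable_open (U : set X) : open U -> measurable (U : set (borel X)).
Proof. exact: sub_sigma_algebra. Qed.

Lemma measurable_closed (F : set X) : closed F -> measurable (F : set (borel X)).
Proof. by move=> cF; rewrite -[F]setCK; apply: measurableC; apply: measurable_open;
  exact: closed_openC. Qed.

(** The sets that are inner regular together with their complements form a sigma-algebra. It
    contains the cylinders over measurable subsets of [T], whose sections are trivial, and those
    over open sets, which are countable unions of closed sets and have closed complements. *)
Lemma inner_closed_measurable S : measurable S -> inner_closed S.
Proof.
pose Q := [set S | [/\ measurable S, inner_closed S & inner_closed (~` S)]].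
suff : measurable `<=` Q by move=> H /H[].
have sQ : sigma_algebra [set: T * borel X] Q.
  split.
  - split; first exact: measurable0.
      by apply: inner_closed_closed => // w; exact: closed0.
    by rewrite setC0; apply: inner_closed_closed.
  - by move=> A [mA iA iA']; rewrite setTD; split; rewrite ?setCK//; exact: measurableC.
  - move=> F QF; split.
    + by apply: bigcup_measurable => n _; case: (QF n).
    + by apply: inner_closed_bigcup => n; case: (QF n).
    + rewrite setC_bigcup; apply: inner_closed_bigcap => n; last by case: (QF n).
      by apply: measurableC; case: (QF n).
have QE : <<s Q >> = Q by exact: sigma_algebra_id.
have QI A C : Q A -> Q C -> Q (A `&` C).
  move=> QA QC; rewrite -QE; apply: (@measurableI _ (g_sigma_algebraType Q));
    by rewrite /measurable/= QE.
have Qfst (D : set T) : measurable D -> Q (D `*` [set: borel X]).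
  have cD (D' : set T) : closed_sections (D' `*` [set: borel X]).
    move=> w; have [D'w|nD'w] := EM (D' w).
      by rewrite (_ : [set x | _] = setT); [exact: closedT|apply/seteqP; split].
    by rewrite (_ : [set x | _] = set0); [exact: closed0|apply/seteqP; split => // x []].
  move=> mD; split; first exact: measurableX.
    by apply: inner_closed_closed; [exact: measurableX|exact: cD].
  rewrite (_ : ~` _ = (~` D) `*` [set: borel X]).
    apply: inner_closed_closed; last exact: cD.
    by apply: measurableX => //; exact: measurableC.
  by apply/seteqP; split => z /=; tauto.
have Qsnd : measurable `<=` [set B : set (borel X) | Q ([set: T] `*` B)].
  apply: smallest_sub.
    case: sQ => s1 s2 s3; split => /=; first by rewrite setX0.
      move=> B QB; rewrite (_ : _ `*` _ = [set: T * borel X] `\` ([set: T] `*` B));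
        first exact: s2.
      by apply/seteqP; split => z /=; tauto.
    by move=> F QF; rewrite setX_bigcupr; exact: s3.
  move=> U oU /=; split.
  - by apply: measurableX => //; exact: measurable_open.
  - have [F [cF <-]] := open_Fsigma oU; rewrite setX_bigcupr.
    apply: inner_closed_bigcup => n.
      by apply: measurableX => //; exact: measurable_closed.
    apply: inner_closed_closed; first by apply: measurableX => //;
      exact: measurable_closed.
    move=> w; rewrite (_ : [set x | _] = F n); first exact: cF.
    by apply/seteqP; split => x /=; tauto.
  - have mCU : measurable (~` ([set: T] `*` U) : set (T * borel X)).
      by apply: measurableC; apply: measurableX => //; exact: measurable_open.
    apply: inner_closed_closed => // w; rewrite (_ : [set x | _] = ~` U).
      exact: open_closedC.
    by apply/seteqP; split => x /=; tauto.
rewrite measurable_prod_measurableType; apply: smallest_sub => //.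
move=> _ [D mD [B mB <-]].
rewrite (_ : D `*` B = (D `*` [set: borel X]) `&` ([set: T] `*` B)).
  by apply: QI; [exact: Qfst|exact: Qsnd].
by apply/seteqP; split => z /=; tauto.
Qed.

End closed_section_approximation.

(** * The joint law of a point and a draw from its kernel *)

Section joint_measure.
Context d (T : measurableType d) (R : realType) (mu : probability T R).
Context d' (Y : measurableType d') (k : R.-pker T ~> Y).

(** The product of [mu] with the kernel [k]: the law of a pair whose first component has law [mu]
    and whose second is drawn from [k w]. *)
Definition joint_measure (S : set (T * Y)) : \bar R :=
  (\int[mu]_w k w (xsection S w))%E.

Let joint0 : joint_measure set0 = 0%E.
Proof. by apply: integral0_eq => w _; rewrite xsection0 measure0. Qed.

Let joint_ge0 S : (0 <= joint_measure S)%E.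
Proof. by apply: integral_ge0 => w _. Qed.

Let joint_sigma_additive : semi_sigma_additive joint_measure.
Proof.
move=> F mF tF mUF.
have -> : joint_measure (\bigcup_n F n) = (\sum_(i <oo) joint_measure (F i))%E.
  rewrite /joint_measure -integral_nneseries//; last first.
    by move=> n; apply: (measurable_fun_xsection_finite_kernel k); rewrite inE.
  apply: eq_integral => w _; rewrite xsection_bigcup measure_semi_bigcup//.
  - by move=> n; exact: measurable_xsection.
  - exact: trivIset_xsection.
  - by apply: bigcup_measurable => n _; exact: measurable_xsection.
by apply: is_cvg_nneseries => n _ _; exact: joint_ge0.
Qed.

HB.instance Definition _ := isMeasure.Build _ _ _ joint_measure
  joint0 joint_ge0 joint_sigma_additive.

Let joint_setT : joint_measure setT = 1%E.
Proof.
rewrite /joint_measure (eq_integral (cst 1%E)); last first.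
  by move=> w _; rewrite (_ : xsection _ _ = setT) ?prob_kernel//; apply/seteqP;
    split => // x _; rewrite /xsection/= inE.
rewrite integral_cst// mul1e; exact: probability_setT.
Qed.

HB.instance Definition _ := Measure_isProbability.Build _ _ _ joint_measure joint_setT.

Lemma joint_measure_ae0 S : measurable S -> joint_measure S = 0%E ->
  {ae mu, forall w, fiber_integral k \1_S w = 0}.
Proof.
move=> mS S0.
have fE w : (fiber_integral k \1_S w)%:E = k w (xsection S w).
  rewrite fiber_integralE; last exact: fiber_integrable_indic1.
  rewrite (eq_integral (fun x => (\1_(xsection S w) x)%:E)).
    by rewrite integral_indic ?setIT//; exact: measurable_xsection.
  by move=> x _; rewrite !indicE mem_xsection.
have mf : measurable_fun [set: T] (EFin \o fiber_integral k \1_S).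
  apply/measurable_EFinP; apply: measurable_fiber_integral.
  exact: fiber_integrable_indic1.
have /(ae_eq_integral_abs mu measurableT mf) :
    (\int[mu]_w `|(EFin \o fiber_integral k \1_S) w| = 0)%E.
  rewrite -S0; apply: eq_integral => w _ /=.
  by rewrite -fE ger0_norm// fiber_integral_ge0// => z; rewrite indicE.
by apply: filterS => w /(_ Logic.I) [].
Qed.

End joint_measure.

(** * Countable covers by sets of small oscillation *)

Section small_cover.
Context d (T : measurableType d) (R : realType) (mu : probability T R).
Context (X : completeMetricType R) (k : R.-pker T ~> borel X).
Context (I : finType) (g : I -> T * borel X -> R).

(** The bound [2 * r] arises from comparing two points of a ball of radius [r] through its
    centre. *)
Definition small_oscillation (r : R) (C : set (T * borel X)) : Prop :=
  forall w (x y : X), C (w, x) -> C (w, y) ->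
    mdist x y < 2 * r /\ forall i, `|g i (w, x) - g i (w, y)| < r.

Lemma open_mdist_ball (a : X) (r : R) : open [set x | mdist a x < r].
Proof.
rewrite openE => x /= ax; have s0 : 0 < r - mdist a x by rewrite subr_gt0.
apply: filterS (nbhsx_ballx x _ s0) => z; rewrite ballEmdist/= => xz.
by apply: le_lt_trans (metric_triangle _ x _) _; rewrite -ltrBrDl.
Qed.

(** Balls around a countable dense set and a grid of mesh [r] for the values of [g] give countably
    many cells [P c] covering everything. Each is exhausted from inside, up to a null set for the
    joint measure, by sets with closed sections, and these inherit the small oscillation. *)
Lemma small_oscillation_cover (X_separable : separable X)
    (mg : forall i, measurable_fun [set: T * borel X] (g i)) (r : R) : 0 < r ->
  exists C : nat -> set (T * borel X),
    [/\ forall j, measurable (C j), forall j, closed_sections (C j),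
      forall j, small_oscillation r (C j) &
      {ae mu, forall w, fiber_integral k \1_(~` (\bigcup_j C j)) w = 0}].
Proof.
move=> r0; have [D cD dD] := X_separable.
have /countable_injP[e einj] := cD.
(* [a] inverts the enumeration [e] of [D]. Numbers that code no point yield a junk centre, which is
   harmless since the oscillation bound holds around any centre. *)
pose a n : X := get [set x | D x /\ e x = n].
have ae_ x : D x -> a (e x) = x.
  move=> Dx; have [Da ea] : [set y | D y /\ e y = e x] (a (e x)) by apply: getPex;
    exists x.
  by apply: einj => //; rewrite inE.
pose P (c : nat * {ffun I -> int}) : set (T * borel X) :=
  ([set: T] `*` [set x | mdist (a c.1) x < r]) `&`
  \bigcap_(i in [set: I]) (g i @^-1` `[(c.2 i)%:~R * r, ((c.2 i)%:~R + 1) * r[).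
have mP c : measurable (P c).
  apply: measurableI; first by apply: measurableX => //; apply: measurable_open;
    exact: open_mdist_ball.
  apply: fin_bigcap_measurable => // i _.
  by rewrite -[X in measurable X]setTI; exact: mg.
have oscP c : small_oscillation r (P c).
  move=> w x y [[_ /= ax] gx] [[_ /= ay] gy]; split.
    apply: le_lt_trans (metric_triangle _ (a c.1) _) _; rewrite (metric_sym x).
    by rewrite mulrDl mul1r ltrD.
  move=> i; have := gx i Logic.I; have := gy i Logic.I; rewrite /= !in_itv/=.
  by rewrite ltr_norml mulrDl mul1r; lra.
have coverP z : exists c, P c z.
  case: z => w x.
  have [y [xy Dy]] : [set y | mdist x y < r] `&` D !=set0.
    by apply: dD; [exists x; rewrite /= mdistxx|exact: open_mdist_ball].
  exists (e y, [ffun i => Num.floor (g i (w, x) / r)]); split.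
    by split => //=; rewrite ae_// metric_sym.
  move=> i _; rewrite /= ffunE in_itv/= -ler_pdivlMr// -ltr_pdivrMr//.
  by rewrite Num.Theory.ge_floor/= -intrD1 Num.Theory.lt_succ_floor.
pose M : probability (T * borel X)%type R := joint_measure mu k.
have innerP c n : exists C, [/\ measurable C, closed_sections C, C `<=` P c &
    set_integral M (cst 1) (P c `\` C) < n.+1%:R^-1].
  by apply: inner_closed_measurable => //; rewrite invr_gt0.
have /choice[C' CP] : forall cn, exists C, [/\ measurable C, closed_sections C, C
  `<=` P cn.1 &
    set_integral M (cst 1) (P cn.1 `\` C) < cn.2.+1%:R^-1] by move=> cn; exact: innerP.
(* A single sequence lists all approximations of all cells; numbers that decode to nothing
   contribute the empty set. *)
pose code j := unpickle j : option ((nat * {ffun I -> int}) * nat).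
pose C j := if code j is Some cn then C' cn else set0.
have mC j : measurable (C j) by rewrite /C; case: (code j) => // cn; case: (CP cn).
exists C; split => //.
- move=> j; rewrite /C; case: (code j) => [cn|w]; last exact: closed0.
  by case: (CP cn).
- move=> j; rewrite /C; case: (code j) => [cn|//].
  by case: (CP cn) => _ _ CPn _ w x y /CPn Px /CPn Py; exact: oscP Px Py.
have mU : measurable (\bigcup_j C j) by exact: bigcup_measurable.
have C'U cn : C' cn `<=` \bigcup_j C j.
  by move=> z ?; exists (pickle cn) => //; rewrite /C /code pickleK.
apply: joint_measure_ae0; first exact: measurableC.
pose codeP j := unpickle j : option (nat * {ffun I -> int}).
pose N j := if codeP j is Some c then P c `\` \bigcup_j C j else set0.
have mN j : measurable (N j) by rewrite /N; case: (codeP j) => // c; exact: measurableD.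
(* What the union misses of [P c] is missed by each of its approximations, so its mass is below
   every [n.+1%:R^-1]. *)
have N0 j : M (N j) = 0%E.
  rewrite /N; case: (codeP j) => [c|]; last exact: measure0.
  have mPU : measurable (P c `\` \bigcup_j C j) by exact: measurableD.
  rewrite prob_set_integral1//; congr EFin; apply/eqP;
    rewrite eq_le set_integral1_ge0 andbT.
  apply/ler_addgt0Pr => s s0; rewrite add0r.
  pose n := Num.truncn s^-1.
  have [mC' _ _ lt_n] := CP (c, n).
  apply: (@le_trans _ _ (set_integral M (cst 1) (P c `\` C' (c, n)))).
    by apply: set_integral1_le => //; [exact: measurableD|exact: setDS].
  apply: (le_trans (ltW lt_n)); rewrite -[leRHS]invrK lef_pV2 ?posrE ?invr_gt0//;
    apply: ltW.
  by have /truncn_itv/andP[] : 0 <= s^-1 by rewrite invr_ge0 ltW.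
have UN : ~` (\bigcup_j C j) `<=` \bigcup_j N j.
  move=> z nCz; have [c Pcz] := coverP z; exists (pickle c) => //.
  by rewrite /N /codeP pickleK.
have : M.-negligible (\bigcup_j N j).
  by apply: negligible_bigcup => j; exists (N j); split; [exact: mN|exact: N0|].
move=> /(negligibleS UN) H; apply: measure_negligible H; exact: measurableC.
Qed.

End small_cover.

(** * Purification *)

Section purification.
Context d (T : measurableType d) (R : realType) (mu : probability T R).
Context (G : set (set T)) (Gsub : is_sub_sigma_algebra G).
Context (noatom : forall D, ~ sub_atom mu G D).
Context (X : completeMetricType R) (X_separable : separable X).
Context (k : R.-pker T ~> borel X).
Context (I : finType) (q : I -> T * borel X -> R).
Context (gq : forall i, fiber_integrable k (q i)).
Context (iq : forall i, (\int[mu]_w (fiber_integral k (q i) w)%:E < +oo)%E).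

Local Notation fint := (fiber_integral k).
Local Notation avg := (fiber_average k).

Let q0 i z : 0 <= q i z. Proof. by case: (gq i). Qed.
Let mq i : measurable_fun [set: T * borel X] (q i). Proof. by case: (gq i). Qed.

(** This form fits [epsilon_trick0], which bounds the sum of the series by 1. *)
Let eps (n : nat) : R := 1 / (2 ^ n.+1)%:R.

Let eps_gt0 n : 0 < eps n.
Proof. by rewrite divr_gt0// ltr0n expn_gt0. Qed.

Let eps_le n m : (n <= m)%N -> eps m <= eps n.
Proof.
move=> nm; rewrite /eps !div1r lef_pV2 ?posrE ?ltr0n ?expn_gt0//.
by rewrite ler_nat leq_exp2l.
Qed.

Let eps_small s : 0 < s -> exists n, forall m, (n <= m)%N -> eps m < s.
Proof.
move=> s0; have [n ns] : exists n : nat, 1 / 2 ^+ n < s.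
  apply: contrapT => H; have : s <= 0; last by rewrite leNgt s0.
  apply: (@le0_halves _ _ 1) => n; rewrite leNgt; apply/negP => H2.
  by apply: H; exists n.
exists n => m nm; apply: le_lt_trans (eps_le nm) _; apply: le_lt_trans ns.
by rewrite /eps natrX !div1r lef_pV2 ?posrE ?exprn_gt0// exprS ler_peMl ?exprn_ge0//
  ler1n.
Qed.

Lemma fiber_average_setT r w : avg setT r w = fint r w.
Proof.
rewrite /fiber_average (eq_fiber_integral k (q := \1_setT) (r := cst 1)); last first.
  by move=> x; rewrite indicT.
rewrite fiber_integral_cst divr1; apply: eq_fiber_integral => x.
by rewrite /= indicT mulr1.
Qed.

(** [charged_stage] is iterated with covers of scale [eps n]. Off [N n] the section of [E n] is
    enclosed in a closed set of small oscillation, so that the estimates also reach limits of points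
    of the section. *)
Let stages : exists (E : nat -> set (T * borel X)) (N : nat -> set T),
  [/\ forall n, charged k (E n) /\ E n.+1 `<=` E n, forall n, measurable (N n),
    forall n w, ~ N n w -> exists2 C : set X, closed C &
      [set x | E n (w, x)] `<=` C /\
      forall x y, C x -> C y -> mdist x y < 2 * eps n /\
        forall i, `|q i (w, x) - q i (w, y)| < eps n,
    forall n, (\int[mu]_(w in N n) (1 + \sum_i avg (E n) (q i) w)%:E <= (eps n)%:E)%E &
    forall n i B, G B -> (\int[mu]_(w in B) (avg (E n) (q i) w)%:E =
                          \int[mu]_(w in B) (fint (q i) w)%:E)%E].
Proof.
have /choice[C CP] := fun n => small_oscillation_cover mu k X_separable mq (eps_gt0 n).
pose P (n : nat) (s : set (T * borel X) * set T) := [/\ charged k s.1,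
  forall i B, G B -> (\int[mu]_(w in B) (avg s.1 (q i) w)%:E =
                      \int[mu]_(w in B) (fint (q i) w)%:E)%E &
  if n is n'.+1 then
    [/\ measurable s.2, forall w, ~ s.2 w -> exists j, forall x, s.1 (w, x) ->
      C n' j (w, x) &
      (\int[mu]_(w in s.2) (1 + \sum_i avg s.1 (q i) w)%:E <= (eps n')%:E)%E]
  else True].
have P0 : P 0%N (setT, set0).
  split => //; first exact: charged_setT.
  by move=> i B GB; apply: eq_integral => w _; rewrite fiber_average_setT.
have step n s : P n s -> exists2 t, P n.+1 t & t.1 `<=` s.1.
  move=> [cs sq _]; have [mC cC oC nC] := CP n.
  have iqs i : (\int[mu]_w (avg s.1 (q i) w)%:E < +oo)%E.
    by rewrite sq//; exact: subG_setT.
  have [E' [N [[cE' E's] mN NC intN E'q]]] :=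
    charged_stage Gsub noatom gq cs iqs mC nC (eps_gt0 n).
  exists (E', N) => //; split => // i B GB; by rewrite E'q// sq.
have [s [_ sP s_]] := dependent_choice_inv P0 step.
(* Shifted by one: [s 0] is the whole space, not yet subordinate to any cover. *)
exists (fun n => (s n.+1).1), (fun n => (s n.+1).2); split => n.
- by split; [case: (sP n.+1)|exact: s_].
- by case: (sP n.+1) => _ _ [].
- move=> w; case: (sP n.+1) => _ _ [_ + _] => /[apply] -[j Cj].
  have [_ /(_ j w) cC /(_ j w) oC _] := CP n.
  by exists [set x : X | C n j (w, x)].
- by case: (sP n.+1) => _ _ [].
- by case: (sP n.+1).
Qed.

Lemma fiber_average_ub E r w (c : R) : fiber_integrable k r -> charged k E -> 0 <= c ->
  (forall x, E (w, x) -> r (w, x) <= c) -> avg E r w <= c.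
Proof.
move=> gr [mE E0] c0 rc; rewrite ler_pdivrMr//.
have gE := fiber_integrable_indic1 k mE.
have -> : c * fint \1_E w = fint (cst c \* \1_E) w.
  by case: gE => _ _ iE; rewrite /fiber_integral -RintegralZl.
apply: fiber_integral_le.
- exact: fiber_integrable_indic.
- by apply: fiber_integrable_indic => //; exact: fiber_integrable_cst.
move=> x /=; rewrite indicE; have [/set_mem Ex|_] := boolP (_ \in _).
  by rewrite !mulr1 rc.
by rewrite !mulr0.
Qed.

Lemma fiber_average_lb E r w (c : R) : fiber_integrable k r -> charged k E -> 0 <= c ->
  (forall x, E (w, x) -> c <= r (w, x)) -> c <= avg E r w.
Proof.
move=> gr [mE E0] c0 rc; rewrite ler_pdivlMr//.
have gE := fiber_integrable_indic1 k mE.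
have -> : c * fint \1_E w = fint (cst c \* \1_E) w.
  by case: gE => _ _ iE; rewrite /fiber_integral -RintegralZl.
apply: fiber_integral_le.
- by apply: fiber_integrable_indic => //; exact: fiber_integrable_cst.
- exact: fiber_integrable_indic.
move=> x /=; rewrite indicE; have [/set_mem Ex|_] := boolP (_ \in _).
  by rewrite !mulr1 rc.
by rewrite !mulr0.
Qed.

Lemma fiber_integral_indic_gt0 E w : measurable E -> 0 < fint \1_E w -> exists x, E
  (w, x).
Proof.
move=> mE E0; apply: contrapT => H; move: E0.
rewrite (eq_fiber_integral k (r := cst 0)) ?fiber_integral_cst ?ltxx// => x.
by rewrite indicE memNset// => Ex; apply: H; exists x.
Qed.

(** By Borel-Cantelli almost every [w] leaves the exceptional sets [N n] eventually. The sections of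
    [E n] then shrink to a point [f w], and the averages over them, whose integrals over [G] never
    change, converge to the payoff at that point. *)
Lemma purification : exists f : T -> X,
  measurable_fun [set: T] (f : T -> borel X) /\
  forall i B, G B ->
    (\int[mu]_(w in B) (q i (w, f w))%:E = \int[mu]_(w in B) (fint (q i) w)%:E)%E.
Proof.
have [E [N [cE mN NC intN Eq]]] := stages.
have mE n : measurable (E n) := (cE n).1.1.
have Ele n m : (n <= m)%N -> E m `<=` E n.
  move=> /subnKC <-; elim: (m - n)%N => [|j IH]; first by rewrite addn0.
  by rewrite addnS; apply: subset_trans IH; exact: (cE (n + j)%N).2.
have m_avg n i : measurable_fun [set: T] (avg (E n) (q i)).
  exact: measurable_fiber_average.
have avg_ge0 n i w : 0 <= avg (E n) (q i) w by exact: fiber_average_ge0.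
pose Z := lim_sup_set N.
have mZ : measurable Z.
  by apply: bigcapT_measurable => n; apply: bigcup_measurable => j _.
(* The integrand in [intN] is at least 1. *)
have muN n : (mu (N n) <= (eps n)%:E)%E.
  apply: le_trans (intN n); rewrite -(mul1e (mu _)) -integral_cst//.
  apply: ge0_le_integral => //.
  - apply/measurable_funTS/measurable_EFinP; apply: measurable_funD => //.
    by apply: measurable_sum => i.
  - by move=> w _; rewrite lee_fin lerDl sumr_ge0.
have muZ : mu Z = 0%E.
  apply: lim_sup_set_cvg0 => //.
  apply: (@le_lt_trans _ _ (\sum_(n <oo) (eps n)%:E)%E).
    by apply: lee_nneseries => [n _ _|n _]; [exact: measure_ge0|exact: muN].
  exact: le_lt_trans (epsilon_trick0 _ ler01) (ltry _).
have NZ w : ~ Z w -> exists n, forall m, (n <= m)%N -> ~ N m w.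
  move=> nZ; apply: contrapT => H; apply: nZ => n _; apply: contrapT => H2.
  by apply: H; exists n => m nm Nm; apply: H2; exists m.
(* The points [e (n, w)] are chosen arbitrarily, with no measurability in [w]; only their limit is
   shown to be measurable. *)
have /choice[e eP] : forall nw : nat * T, exists x, E nw.1 (nw.2, x).
  move=> [n w]; apply: fiber_integral_indic_gt0 => //; exact: (cE n).1.2.
(* The constant default on the null set [Z] keeps [f] measurable without completeness. *)
pose f w : X := if w \in Z then point else lim (e (n, w) @[n --> \oo]).
have fcvg w : ~ Z w -> e (n, w) @[n --> \oo] --> f w.
  move=> nZ; rewrite /f memNset//; apply: cauchy_cvg; apply: cauchy_exP => s s0.
  have [n1 n1P] := NZ _ nZ.
  have s20 : 0 < s / 2 by rewrite divr_gt0.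
  have [n2 n2P] := eps_small s20.
  pose n := maxn n1 n2; exists (e (n, w)).
  exists n => // m /= nm; rewrite ballEmdist/=.
  have [C _ [EC Cd]] := NC n w (n1P n (leq_maxl _ _)).
  have [] := Cd (e (n, w)) (e (m, w)); [exact: EC (eP (n, w))| |].
    exact: EC (Ele _ _ nm _ (eP (m, w))).
  move=> lt_d _; apply: lt_trans lt_d _.
  by have := n2P n (leq_maxr _ _); rewrite ltr_pdivlMr// mulrC.
(* The tail of the sequence stays in the closed set enclosing the section of [E n], hence so does
   [f w]. *)
have key w n : ~ Z w -> ~ N n w -> forall x, E n (w, x) ->
    mdist (f w) x < 2 * eps n /\ forall i, `|q i (w, f w) - q i (w, x)| < eps n.
  move=> nZ nN x Ex; have [C cC [EC Cd]] := NC n w nN.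
  apply: Cd; last exact: EC.
  apply: (closed_cvg C cC _ (f w) (fcvg _ nZ)).
  by exists n => // m /= nm; exact: EC (Ele _ _ nm _ (eP (m, w))).
exists f.
have mf : measurable_fun [set: T] (f : T -> borel X).
  apply: (measurability (rT := borel X) (@open X)) => // _ [U oU <-]; rewrite setTI.
  pose K := ~` U; have cK : closed K by exact: open_closedC.
  pose Kr n : set X := \bigcup_(y in K) [set x | mdist y x < 2 * eps n].
  have oKr n : open (Kr n) by apply: bigcup_open => y _; exact: open_mdist_ball.
  pose EK n := E n `&` ([set: T] `*` (Kr n : set (borel X))).
  have mEK n : measurable (EK n).
    by apply: measurableI => //; apply: measurableX => //; exact: measurable_open.
  pose H n := [set w | 0 < fint \1_(EK n) w].
  have mH n : measurable (H n).
    rewrite (_ : H n = fint \1_(EK n) @^-1` `]0, +oo[); last first.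
      by apply/seteqP; split => w /=; rewrite in_itv/= andbT.
    rewrite -[X in measurable X]setTI.
    by apply: (measurable_fiber_integral (fiber_integrable_indic1 k (mEK n))).
  (* For all large n, [E n] lies within [2 * eps n] of [f w]. *)
  have fK : f @^-1` K = (Z `&` [set w | K point]) `|`
      (~` Z `&` \bigcap_n (N n `|` H n)).
    apply/seteqP; split => w /=.
      have [Zw|nZ] := EM (Z w); first by rewrite /f mem_set//; left.
      move=> Kfw; right; split => // n _; have [?|nN] := EM (N n w); [by left|right].
      rewrite /H/= (eq_fiber_integral k (r := \1_(E n))); first exact: (cE n).1.2.
      move=> x; rewrite !indicE in_setI; have [/set_mem Ex|//] := boolP (_ \in E n).
      rewrite mem_set//; split => //=; exists (f w) => //=.
      by have [] := key w n nZ nN x Ex.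
    move=> [[Zw Kp]|[nZ NH]]; first by rewrite /f mem_set.
    apply: contrapT => nKf.
    have := closed_openC cK; rewrite openE => /(_ _ nKf) /nbhs_ballP[s /= s0 sK].
    have [n1 n1P] := NZ _ nZ.
    have s40 : 0 < s / 4 by rewrite divr_gt0.
    have [n2 n2P] := eps_small s40.
    pose n := maxn n1 n2; have nN : ~ N n w by apply: n1P; exact: leq_maxl.
    have ns : eps n < s / 4 by apply: n2P; exact: leq_maxr.
    have [//|/fiber_integral_indic_gt0-/(_ (mEK n))[x [Ex [_ [y Ky /= yx]]]]] :=
      NH n Logic.I.
    have [fx _] := key w n nZ nN x Ex.
    apply: (sK y _ Ky); rewrite ballEmdist/=.
    apply: le_lt_trans (metric_triangle _ x _) _; rewrite (metric_sym x y).
    apply: lt_le_trans (ltrD fx yx) _; lra.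
  rewrite -[f @^-1` U]setCK preimage_setC -/K fK; apply: measurableC.
  apply: measurableU; apply: measurableI => //.
  - by have [Kp|nKp] := EM (K point); [rewrite (_ : [set w | _] = setT)|
      rewrite (_ : [set w | _] = set0)] => //; apply/seteqP; split.
  - exact: measurableC.
  - by apply: bigcapT_measurable => n; exact: measurableU.
split => // i B GB; have mB := subG_measurable Gsub GB.
pose h w := q i (w, f w).
have mh : measurable_fun [set: T] (EFin \o h).
  apply/measurable_EFinP; apply: (measurableT_comp (mq i)).
  exact: measurable_fun_pair.
have h0 w : (0 <= (h w)%:E)%E by rewrite lee_fin; exact: q0.
have close w n : ~ Z w -> ~ N n w -> avg (E n) (q i) w <= h w + eps n /\
    h w <= avg (E n) (q i) w + eps n.
  move=> nZ nN; have hE x : E n (w, x) -> `|h w - q i (w, x)| < eps n.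
    by move=> Ex; have [_ H] := key w n nZ nN x Ex; exact: H.
  have hw0 : 0 <= h w by exact: q0.
  split.
    apply: fiber_average_ub => //; [exact: (cE n).1|by rewrite addr_ge0// ltW|].
    by move=> x /hE; rewrite ltr_norml; lra.
  rewrite -lerBlDr; have [hn|nh] := leP 0 (h w - eps n); last first.
    by apply: le_trans (avg_ge0 n i w); exact: ltW.
  apply: fiber_average_lb => //; first exact: (cE n).1.
  by move=> x /hE; rewrite ltr_norml; lra.
have int_shift (u : T -> R) (c : R) D : measurable_fun [set: T] u -> (forall w, 0 <=
  u w) ->
    0 <= c -> measurable D -> D `<=` B ->
    (\int[mu]_(w in D) (u w + c)%:E <= \int[mu]_(w in B) (u w)%:E + c%:E)%E.
  move=> mu_ u0 c0 mD DB; under eq_integral do rewrite EFinD.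
  rewrite ge0_integralD//; last 2 first.
  - by move=> w _; rewrite lee_fin.
  - by apply/measurable_EFinP; exact: measurable_funTS.
  apply: leeD.
    apply: ge0_subset_integral => //; last by move=> w _; rewrite lee_fin.
    by apply/measurable_EFinP; exact: measurable_funTS.
  rewrite integral_cst// -[leRHS]mule1; apply: lee_wpmul2l; first by rewrite lee_fin.
  exact: probability_le1.
apply/eqP; rewrite eq_le; apply/andP; split.
(* Upper bound for the payoff of [f]: on [W n] no later exceptional set interferes, so [h] exceeds
   the averages of all stages [m >= n] by at most [eps m]. The sets [W n] increase to [B] without
   [Z], and monotone convergence concludes. *)
- pose W n := B `\` (Z `|` \bigcup_(j >= n) N j).
  have mW n : measurable (W n).
    by apply: measurableD => //; apply: measurableU => //; exact: bigcup_measurable.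
  have UW : \bigcup_n W n = B `\` Z.
    apply/seteqP; split => w; first by move=> [n _ [Bw nZ]]; split => //;
      apply: contra_not nZ; left.
    move=> [Bw nZ]; have [n nP] := NZ _ nZ; exists n => //; split => //.
    by move=> [//|[j /= nj Nj]]; exact: (nP j nj).
  have W_le n : (\int[mu]_(w in W n) (h w)%:E <= \int[mu]_(w in B) (fint (q i) w)%:E)%E.
    apply/lee_addgt0Pr => s s0; have [n2 n2P] := eps_small s0.
    pose m := maxn n n2; rewrite -(Eq m i B GB).
    apply: (@le_trans _ _ (\int[mu]_(w in W n) (avg (E m) (q i) w + eps m)%:E)%E).
      apply: ge0_le_integral => //.
      - exact: measurable_funTS.
      - by apply/measurable_EFinP; apply: measurable_funTS; exact: measurable_funD.
      move=> w [Bw nZN]; rewrite lee_fin; apply: (close w m _ _).2.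
        by apply: contra_not nZN; left.
      by apply: contra_not nZN; right; exists m => //=; exact: leq_maxl.
    apply: le_trans (int_shift _ _ _ (m_avg m i) _ _ (mW n) _) _ => //.
    - exact/ltW/eps_gt0.
    - exact: subDsetl.
    by rewrite leeD2l// lee_fin; apply/ltW/n2P; exact: leq_maxr.
  rewrite (ge0_negligible_integral mZ mB (measurable_funTS mh) (fun w _ => h0 w) muZ).
  rewrite -UW.
  have cv : (\int[mu]_(w in W n) (h w)%:E)%E @[n --> \oo] --> (\int[mu]_(w in
    \bigcup_n W n) (h w)%:E)%E.
    apply: ge0_nondecreasing_set_cvg_integral => //.
      apply/nondecreasing_seqP => n; apply/subsetPset => w [Bw nZN]; split => //.
      by move=> [Zw|[j /= nj Nj]]; apply: nZN; [left|right; exists j => //=; exact: ltnW].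
    by move=> n; exact: measurable_funTS.
  rewrite -(cvg_lim _ cv)//; apply: lime_le; first by apply/cvg_ex; eexists; exact: cv.
  exact: nearW.
(* Lower bound: one error [eps n] comes from the integral of the average over [N n], bounded by
   [intN], another from the oscillation off [N n]; hence [s / 2]. *)
- apply/lee_addgt0Pr => s s0; have s20 : 0 < s / 2 by rewrite divr_gt0.
  have [n /(_ n (leqnn n)) ns] := eps_small s20.
  have mBZ : measurable (B `\` Z) by exact: measurableD.
  have mD1 : measurable ((B `\` Z) `&` N n) by exact: measurableI.
  have mD2 : measurable ((B `\` Z) `\` N n) by exact: measurableD.
  rewrite -(Eq n i B GB) (ge0_negligible_integral mZ mB)//; last 2 first.
  - by apply/measurable_EFinP; exact: measurable_funTS.
  - by move=> w _; rewrite lee_fin.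
  rewrite -(setUIDK (B `\` Z) (N n)) ge0_integral_setU//; last 3 first.
  - by apply/measurable_EFinP; exact: measurable_funTS.
  - by move=> w _; rewrite lee_fin.
  - by apply/disj_setPS => w [[_ ?] [_ ?]].
  apply: (@le_trans _ _ ((eps n)%:E + (\int[mu]_(w in B) (h w)%:E + (eps n)%:E))%E).
    apply: leeD.
      apply: le_trans (intN n);
        apply: (@le_trans _ _ (\int[mu]_(w in N n) (avg (E n) (q i) w)%:E)%E).
        apply: ge0_subset_integral => //.
        - by apply/measurable_EFinP; exact: measurable_funTS.
        - by move=> w _; rewrite lee_fin.
      apply: ge0_le_integral => //.
      - by move=> w _; rewrite lee_fin.
      - by apply/measurable_EFinP; exact: measurable_funTS.
      - apply/measurable_funTS/measurable_EFinP; apply: measurable_funD => //.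
        by apply: measurable_sum => j.
      - move=> w _; rewrite lee_fin (bigD1 i)//= addrCA lerDl addr_ge0//.
        exact: sumr_ge0.
    apply: (@le_trans _ _ (\int[mu]_(w in (B `\` Z) `\` N n) (h w + eps n)%:E)%E).
      apply: ge0_le_integral => //.
      - by move=> w _; rewrite lee_fin.
      - by apply/measurable_EFinP; exact: measurable_funTS.
      - apply/measurable_EFinP; apply: measurable_funTS; apply: measurable_funD => //.
        exact/measurable_EFinP.
      - by move=> w [[_ nZ] nN]; rewrite lee_fin; exact: (close w n nZ nN).1.
    apply: int_shift => //; first exact/measurable_EFinP.
    - exact/ltW/eps_gt0.
    - by move=> w [[]].
  rewrite addeCA -EFinD leeD2l// lee_fin; lra.
Qed.

End purification.

(** * Kernels measurable for the weak topology *)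

Section distance_to_set.
Context (R : realType) (X : completeMetricType R).
Implicit Type F : set X.

Definition set_distance F (x : X) : R := inf [set mdist x y | y in F].

Lemma set_distance_ge0 F x : F !=set0 -> 0 <= set_distance F x.
Proof.
move=> [y Fy]; apply: lb_le_inf; first by exists (mdist x y), y.
by move=> _ [z Fz <-]; exact: mdist_ge0.
Qed.

Lemma set_distance_le F x y : F y -> set_distance F x <= mdist x y.
Proof.
move=> Fy; apply: ge_inf; last by exists y.
by exists 0 => _ [z Fz <-]; exact: mdist_ge0.
Qed.

Lemma set_distance_lip F x x' : F !=set0 ->
  set_distance F x <= mdist x x' + set_distance F x'.
Proof.
move=> F0; rewrite -lerBlDl; apply: lb_le_inf.
  by case: F0 => y Fy; exists (mdist x' y), y.
move=> _ [y Fy <-]; rewrite lerBlDl.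
exact: le_trans (set_distance_le x Fy) (metric_triangle _ _ _).
Qed.

Lemma continuous_set_distance F : F !=set0 -> continuous (set_distance F : X -> R).
Proof.
move=> F0 x; apply/cvgrPdist_lt => e e0.
near=> z.
have xz : mdist x z < e.
  by near: z; have := nbhsx_ballx x _ e0; apply: filterS => z; rewrite ballEmdist.
have := set_distance_lip x z F0; have := set_distance_lip z x F0.
rewrite (metric_sym z x) ltr_norml => h1 h2; apply/andP; split; lra.
Unshelve. all: by end_near. Qed.

Lemma set_distance_eq0 F x : closed F -> F !=set0 -> set_distance F x = 0 -> F x.
Proof.
move=> cF F0 d0; apply: contrapT => nFx.
have := closed_openC cF; rewrite openE => /(_ _ nFx) /nbhs_ballP[e /= e0 eF].
have : e <= set_distance F x.
  apply: lb_le_inf; first by case: F0 => y Fy; exists (mdist x y), y.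
  move=> _ [y Fy <-]; rewrite leNgt; apply/negP => xy.
  by apply: (eF y _ Fy); rewrite ballEmdist.
by rewrite d0 leNgt e0.
Qed.

Lemma set_distance0 F x : F x -> set_distance F x = 0.
Proof.
move=> Fx; apply/eqP; rewrite eq_le set_distance_ge0; last by exists x.
by rewrite andbT -(mdistxx x); exact: set_distance_le.
Qed.

End distance_to_set.

Lemma continuous_pointwise_eval (I : Type) (V : topologicalType) (i : I) :
  continuous ((fun u => u i) : {ptws I -> V} -> V).
Proof.
move=> f; have /cvg_sup/(_ i) h : f --> f by apply: cvg_id.
move=> B fB; apply: h.
exact: (initial_continuous (f := fun u : I -> V => u i) fB).
Qed.

Section weakly_measurable_kernel.
Context d (T : measurableType d) (R : realType) (X : completeMetricType R).
Context (phi : T -> probability (borel X) R).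

(** The measurability proof is an argument because the kernel instances attached to this constant
    depend on it. *)
Definition weak_kernel
    (mphi : measurable_fun [set: T] (phi : T -> borel (weak_probability R X)))
    (w : T) : {measure set (borel X) -> \bar R} := phi w.

Context (mphi : measurable_fun [set: T] (phi : T -> borel (weak_probability R X))).

(** The measures whose integral of [h] exceeds [a] form a weakly open set. *)
Lemma measurable_test_integral (h : bounded_continuous R X) :
  measurable_fun [set: T] (fun w => \int[phi w]_x sval h x).
Proof.
apply: (measurability _ (RGenOInfty.measurableE R)) => // _ [_ [a ->] <-].
rewrite setTI.
pose O : set (weak_probability R X) := [set nu | a < test_integrals nu h].
have oO : open O.
  exists [set u : {ptws bounded_continuous R X -> R} | a < u h] => //.
  exact: ((continuousP _).1 (continuous_pointwise_eval (V := R) (i :=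
    h)) _ (@open_gt _ a)).
have mO : measurable (O : set (borel (weak_probability R X))) by exact: sub_sigma_algebra.
have := mphi measurableT mO.
rewrite setTI; congr measurable; apply/seteqP; split => w /=; rewrite in_itv/= andbT//.
Qed.

(** The indicator of a closed set is the limit of the powers of [u], a continuous function with
    values in [0, 1] that equals 1 exactly on [F]; the mass of [F] is then a limit of test integrals
    by dominated convergence. *)
Lemma measurable_closed_mass (F : set X) : closed F ->
  measurable_fun [set: T] (fun w => phi w F).
Proof.
(* The empty set is treated apart, as the distance to it is a junk value. *)
move=> cF; have [F0|/eqP/negP/negP] := EM (F = set0).
  by rewrite F0; under eq_fun do rewrite measure0; exact: measurable_cst.
move=> /set0P F0.
pose u (x : X) : R := expR (- set_distance F x).
have u01 x : 0 <= u x <= 1.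
  by rewrite expR_ge0/= expR_le1 oppr_le0 set_distance_ge0.
have cu : continuous u.
  move=> x; apply: (@continuous_comp _ _ _ (fun x => - set_distance F x) expR).
    by apply: continuousN; exact: continuous_set_distance.
  exact: continuous_expR.
have cun n : continuous (fun x => u x ^+ n).
  by move=> x; apply: (@continuous_comp _ _ _ u (fun r => r ^+ n));
    [exact: cu|exact: exprn_continuous].
have un01 n x : 0 <= u x ^+ n <= 1.
  by case/andP: (u01 x) => u0 u1; rewrite exprn_ge0// exprn_ile1.
have bun n : [bounded u x ^+ n | x in [set: X]].
  exists 1; split => // M M1 x _ /=; case/andP: (un01 n x) => h0 h1.
  by rewrite ger0_norm//; apply: le_trans h1 (ltW M1).
pose h n : bounded_continuous R X := exist _ (fun x => u x ^+ n) (conj (cun n) (bun n)).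
have mun n : measurable_fun [set: borel X] (fun x => u x ^+ n).
  apply: (measurability _ (RGenOInfty.measurableE R)) => // _ [_ [a ->] <-].
  rewrite setTI; apply: measurable_open.
  have := (continuousP _).1 (cun n) _ (@open_gt _ a); congr open.
  by apply/seteqP; split => x /=; rewrite in_itv/= andbT.
have mF : measurable (F : set (borel X)) := measurable_closed cF.
have ucvg x : (u x ^+ n) @[n --> \oo] --> (\1_F x : R).
  have [Fx|nFx] := EM (F x).
    rewrite (_ : (fun n => _) = cst (\1_F x)); first exact: cvg_cst.
    apply/funext => n; rewrite indicE mem_set//= /u set_distance0// oppr0 expR0.
    by rewrite expr1n.
  rewrite indicE memNset//; apply: cvg_expr.
  case/andP: (u01 x) => u0 u1; rewrite ger0_norm// /u -expR0 ltr_expR oppr_lt0.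
  rewrite lt_neqAle set_distance_ge0// andbT; apply/eqP => d0.
  by apply: nFx; exact: set_distance_eq0.
have ih n w : (phi w).-integrable [set: borel X] (EFin \o (fun x => u x ^+ n)).
  apply: (integrable_bound (h := cst 1)) => //.
    exact: finite_measure_integrable_cst.
  by move=> x; case/andP: (un01 n x) => h0 h1; rewrite /= normr1 ger0_norm.
apply: (emeasurable_fun_cvg (fun n w => (\int[phi w]_x sval (h n) x)%:E)).
  by move=> n; apply/measurable_EFinP; exact: measurable_test_integral.
move=> w _ /=.
have [|||||_ _ cv] := dominated_convergence (mu := phi w) measurableT
    (f_ := fun n x => (u x ^+ n)%:E) (f := fun x => (\1_F x)%:E) (g := cst 1%E).
- by move=> n; exact/measurable_EFinP.
- by apply/measurable_EFinP; exact: measurable_indic.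
- apply: aeW => x _; apply: cvg_EFin; first exact: nearW.
  exact: ucvg.
- exact: finite_measure_integrable_cst.
- apply: aeW => x n _; case/andP: (un01 n x) => h0 h1.
  by rewrite lee_fin ger0_norm.
rewrite integral_indic// setIT in cv; apply: cvg_trans cv; apply: near_eq_cvg.
apply: nearW => n; rewrite /Rintegral fineK//.
by apply: integrable_fin_num => //; exact: ih.
Qed.

(** Dynkin's theorem for the closed sets, which are stable under intersection and generate the Borel
    sets. *)
Lemma measurable_mass (U : set (borel X)) : measurable U ->
  measurable_fun [set: T] (fun w => phi w U).
Proof.
pose C := [set F : set (borel X) | @closed X F].
have CE : @measurable _ (borel X) = <<s C >>.
  apply/seteqP; split; apply: smallest_sub; try exact: smallest_sigma_algebra.
    move=> U' oU; rewrite -[U']setCK -setTD; apply: sigma_algebraCD.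
    by apply: sub_sigma_algebra; exact: open_closedC.
  by move=> F cF; exact: measurable_closed.
rewrite CE; apply: (dynkin_induction (P := [set U' : set (borel X) |
    measurable_fun [set: T] (fun w => phi w U')])) => //=.
- by move=> A B; exact: closedI.
- by under eq_fun do rewrite probability_setT; exact: measurable_cst.
- by move=> F; exact: measurable_closed_mass.
- move=> S mS mfS; rewrite (_ : (fun w => _) = (fun w => 1 - phi w S)%E).
    by apply: emeasurable_funB => //; exact: measurable_cst.
  by apply/funext => w; rewrite probability_setC.
- move=> F mF tF mfF.
  rewrite (_ : (fun w => _) = (fun w => \sum_(n <oo) phi w (F n))%E).
    by apply: ge0_emeasurable_sum => // n w _ _.
  apply/funext => w; rewrite measure_semi_bigcup//.
  exact: bigcup_measurable.
Qed.

HB.instance Definition _ :=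
  isKernel.Build _ _ _ _ _ (weak_kernel mphi) measurable_mass.

Let weak_kernel_setT w : weak_kernel mphi w [set: borel X] = 1%E.
Proof. exact: probability_setT. Qed.

HB.instance Definition _ :=
  Kernel_isProbability.Build _ _ _ _ _ (weak_kernel mphi) weak_kernel_setT.

End weakly_measurable_kernel.

(** * From integrals over the sub-sigma-algebra to conditional expectations *)

(** Both functions have the same set of versions, so [get] picks the same one: the equality holds
    everywhere, not just almost everywhere. *)
Lemma eq_cond_exp d (T : measurableType d) (R : realType) (mu : probability T R)
    (G : set (set T)) (h1 h2 : T -> R) :
  (forall B, G B ->
    (\int[mu]_(w in B) (h1 w)%:E = \int[mu]_(w in B) (h2 w)%:E)%E) ->
  cond_exp mu G h1 = cond_exp mu G h2.
Proof.
move=> h12; rewrite /cond_exp; congr get; apply/seteqP; split => e [me ie eE];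
  by split => // B GB; rewrite eE// h12.
Qed.

(** Inside the null set [N] every preimage is measurable by completeness. *)
Lemma complete_measurable_fun d (T : measurableType d) (R : realType)
    (mu : probability T R) d' (Y : measurableType d') (f0 f : T -> Y) (N : set T) :
  measure_is_complete mu -> measurable N -> mu N = 0%E ->
  (forall w, ~ N w -> f w = f0 w) ->
  measurable_fun [set: T] f0 -> measurable_fun [set: T] f.
Proof.
move=> cmu mN N0 ff0 mf0 _ U mU; rewrite setTI.
rewrite (_ : f @^-1` U = (f0 @^-1` U `\` N) `|` (f @^-1` U `&` N)).
  apply: measurableU; first by apply: measurableD => //;
    rewrite -[X in measurable X]setTI; exact: mf0.
  by apply: cmu; exists N; split => // w [].
apply/seteqP; split => w /=.
  by move=> fU; have [Nw|nN] := EM (N w); [right|left; rewrite -ff0].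
by move=> [[+ nN]|[]//]; rewrite ff0.
Qed.

Theorem theorem1 (d : measure_display) (Omega : measurableType d)
    (R : realType) (mu : probability Omega R)
    (mu_complete : measure_is_complete mu) (mu_nonatomic : nonatomic mu)
    (X : completeMetricType R) (X_separable : separable X)
    (A : Omega -> set X) (A_nonempty : forall w, A w !=set0)
    (graph_measurable : measurable (graph A))
    (n : nat) (g : 'I_n -> Omega * borel X -> R)
    (g_measurable : forall i, measurable_fun (graph A) (g i))
    (phi : Omega -> probability (borel X) R)
    (phi_randomized : randomized_decision A phi)
    (g_integrable : forall i,
      (\int[mu]_w \int[phi w]_(x in A w) `|(g i (w, x))%:E| < +oo)%E)
    (G : set (set Omega)) (G_sub : is_sub_sigma_algebra G)
    (G_no_atoms : forall D : set Omega, ~ sub_atom mu G D) :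
  exists f : Omega -> X,
    [/\ decision A f,
        forall i, mu.-integrable [set: Omega]
          (EFin \o (fun w => g i (w, f w))) &
        {ae mu, forall w,
          cond_expv mu G (I_randomized A g phi) w
            = cond_expv mu G (I_pure g f) w}].
Proof.
case: phi_randomized => mphi phiA.
pose k : R.-pker Omega ~> borel X := weak_kernel mphi.
(* [g i] is only measurable on the graph, so it is extended by 0 to the whole product. *)
pose gA i := g i \_ (graph A).
have mgA i : measurable_fun [set: Omega * borel X] (gA i).
  exact/(measurable_restrictT _ graph_measurable).
have mAw w : measurable (A w : set (borel X)).
  have := measurable_xsection w graph_measurable; congr measurable.
  by apply/seteqP; split => x; rewrite /xsection/= inE.
have gAE i w x : gA i (w, x) = (fun x => g i (w, x)) \_ (A w) x.
  rewrite /gA !patchE.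
  by rewrite (_ : ((w, x) \in graph A) = (x \in A w))//; apply/idP/idP; rewrite !inE.
pose v i w := (\int[k w]_x `|gA i (w, x)|%:E)%E.
have vE i w : (\int[phi w]_(x in A w) `|(g i (w, x))%:E| = v i w)%E.
  rewrite integral_mkcond; apply: eq_integral => x _.
  by rewrite gAE !patchE; case: ifP; rewrite ?normr0.
have v0 i w : (0 <= v i w)%E by apply: integral_ge0 => x _; rewrite lee_fin.
have mv i : measurable_fun [set: Omega] (v i).
  apply: (measurable_fun_integral_finite_kernel (fun z => `|gA i z|%:E) k) => //.
  by apply/measurable_EFinP; exact: measurableT_comp.
have iv i : mu.-integrable [set: Omega] (v i).
  apply/integrableP; split => //; apply: le_lt_trans (g_integrable i).
  apply: ge0_le_integral => //.
  - exact: measurableT_comp.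
  - by rewrite (_ : (fun w => _) = v i)//; apply/funext => w; rewrite vE.
  - by move=> w _; rewrite vE gee0_abs.
(* [fiber_integrable] asks for integrability over every fiber, while the hypothesis gives it for
   almost every one; the payoffs will be cut off outside [F]. *)
pose F := \bigcap_(i in [set: 'I_n]) (v i @^-1` [set x | x \is a fin_num]).
have mF : measurable F.
  apply: fin_bigcap_measurable => // i _; rewrite -[X in measurable X]setTI.
  exact: emeasurable_fin_num.
have aeF : {ae mu, forall w, F w}.
  (* The finite union over ['I_n] is padded with empty sets to a countable one. *)
  have [N [mN N0 NF]] : mu.-negligible (\bigcup_j ~` (if insub j is Some i then
      v i @^-1` [set x | x \is a fin_num] else [set: Omega])).
    apply: negligible_bigcup => j; case: insubP => [i _ _|_]; last first.
      by rewrite setCT; exact: negligible_set0.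
    have [N [mN N0 NP]] := integrable_ae measurableT (iv i).
    by exists N; split => // w nw; apply: NP => /= /(_ Logic.I).
  exists N; split => // w nF; apply: NF; apply: contrapT => nU; apply: nF => i _.
  apply: contrapT => nv; apply: nU; exists i => //=; rewrite insubT//=.
  by move=> lt_i; rewrite (_ : Sub _ _ = i)//; exact: val_inj.
have vfin w i : F w -> v i w \is a fin_num by move=> /(_ i Logic.I).
pose Fc : set (Omega * borel X) := F `*` [set: borel X].
have mFc : measurable Fc by exact: measurableX.
pose pos i z := Num.max (gA i z) 0.
pose neg i z := Num.max (- gA i z) 0.
(* Purification handles nonnegative payoffs: the positive and negative parts of each [gA i], and the
   indicator of the complement of the graph, which encodes the constraint. *)
pose q (j : option ('I_n * bool)) : Omega * borel X -> R := match j with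
  | Some (i, true) => pos i \* \1_Fc
  | Some (i, false) => neg i \* \1_Fc
  | None => \1_(~` graph A) end.
have mpos i : measurable_fun [set: Omega * borel X] (pos i).
  by apply: measurable_maxr => //.
have mneg i : measurable_fun [set: Omega * borel X] (neg i).
  by apply: measurable_maxr => //; exact: measurableT_comp.
have pos0 i z : 0 <= pos i z by rewrite le_max lexx orbT.
have neg0 i z : 0 <= neg i z by rewrite le_max lexx orbT.
have pos_le i z : pos i z <= `|gA i z| by rewrite ge_max ler_norm normr_ge0.
have neg_le i z : neg i z <= `|gA i z| by rewrite ge_max -normrN ler_norm normr_ge0.
have posneg i z : pos i z - neg i z = gA i z.
  by rewrite /pos /neg; case: (leP (gA i z) 0) => h; case: (leP (- gA i z) 0) => h'; lra.
have good_le (r : Omega * borel X -> R) i : measurable_fun [set: Omega * borel X] r ->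
    (forall z, 0 <= r z <= `|gA i z|) -> fiber_integrable k (r \* \1_Fc).
  move=> mr rg; split.
  - by apply: measurable_funM => //; exact: measurable_indic.
  - by move=> z; case/andP: (rg z) => r0 _; rewrite mulr_ge0// indicE.
  move=> w; have [Fw|nFw] := EM (F w); last first.
    rewrite (_ : EFin \o _ = cst 0%E); first exact: integrable0.
    by apply/funext => x; rewrite /= indicE memNset ?mulr0// => -[].
  apply/integrableP; split.
    apply/measurable_EFinP; apply: (measurable_fiber w (q := r \* \1_Fc)).
    by apply: measurable_funM => //; exact: measurable_indic.
  apply: (@le_lt_trans _ _ (v i w)); last by rewrite ltey_eq vfin.
  apply: ge0_le_integral => //.
  - apply: measurableT_comp => //; apply/measurable_EFinP.
    apply: (measurable_fiber w (q := r \* \1_Fc)).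
    by apply: measurable_funM => //; exact: measurable_indic.
  - apply/measurable_EFinP; apply: measurableT_comp => //.
    exact: measurable_fiber.
  - move=> x _; rewrite /= lee_fin indicE mem_set//= mulr1.
    by case/andP: (rg (w, x)) => r0 rle; rewrite ger0_norm.
have gq j : fiber_integrable k (q j).
  case: j => [[i []]|] /=.
  - by apply: (good_le _ i) => // z; rewrite pos0 pos_le.
  - by apply: (good_le _ i) => // z; rewrite neg0 neg_le.
  - by apply: fiber_integrable_indic1; exact: measurableC.
have q0 j z : 0 <= q j z by case: (gq j).
have mq j : measurable_fun [set: Omega * borel X] (q j) by case: (gq j).
have q_le i b z : q (Some (i, b)) z <= `|gA i z|.
  by case: b; rewrite /= indicE; case: (z \in Fc); rewrite ?mulr1 ?mulr0.
have fintN w : fiber_integral k (q None) w = 0.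
  apply: EFin_inj; rewrite fiber_integralE//.
  rewrite (eq_integral (fun x : borel X => (\1_(~` A w : set (borel X)) x)%:E));
    last first.
    by move=> x _; rewrite /= !indicE; congr (_%:R%:E); apply/idP/idP; rewrite !inE.
  rewrite integral_indic//; last exact: measurableC.
  by rewrite setIT; have := probability_setC (phi w) (mAw w); rewrite phiA subee.
have iq j : (\int[mu]_w (fiber_integral k (q j) w)%:E < +oo)%E.
  case: j => [[i b]|]; last first.
    by rewrite (eq_integral (cst 0%E)) ?integral0// => w _; rewrite fintN.
  have /integrableP[_ vlty] := iv i; apply: le_lt_trans vlty.
  apply: ge0_le_integral => //.
  - by move=> w _; rewrite lee_fin fiber_integral_ge0.
  - by apply/measurable_EFinP; exact: measurable_fiber_integral.
  - exact: measurableT_comp.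
  move=> w _; rewrite fiber_integralE// gee0_abs//; apply: ge0_le_integral => //.
  - by move=> x _; rewrite lee_fin.
  - by apply/measurable_EFinP; exact: measurable_fiber.
  - by apply/measurable_EFinP; apply: measurableT_comp => //; exact: measurable_fiber.
  - by move=> x _; rewrite lee_fin q_le.
have [f0 [mf0 f0P]] := purification G_sub G_no_atoms X_separable gq iq.
have mid (f' : Omega -> X) : measurable_fun [set: Omega] (f' : Omega -> borel X) ->
    measurable_fun [set: Omega] ((fun w => (w, f' w)) : Omega -> Omega * borel X).
  by move=> mf'; exact: measurable_fun_pair.
pose N1 := [set w | ~ A w (f0 w)].
have mN1 : measurable N1.
  have := mid _ mf0 measurableT _ (measurableC graph_measurable).
  by rewrite setTI.
(* The payoff [None] has fiber integrals 0 because [phi w] is carried by [A w]; purification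
   preserves its integral, so [f0] leaves [A] only on a null set. *)
have muN1 : mu N1 = 0%E.
  rewrite -[N1]setIT -integral_indic// (eq_integral (fun w => (q None (w, f0 w))%:E)).
    rewrite f0P; last exact: subG_setT.
    by rewrite (eq_integral (cst 0%E)) ?integral0// => w _; rewrite fintN.
  by move=> w _; rewrite /= !indicE; congr (_%:R%:E); apply/idP/idP; rewrite !inE.
(* An arbitrary selection suffices on the null set [N1]: completeness of [mu] makes the modified
   function measurable. *)
have /choice[a aP] := A_nonempty.
pose f w : X := if w \in N1 then a w else f0 w.
have ff0 w : ~ N1 w -> f w = f0 w by move=> nN1; rewrite /f memNset.
have fA w : A w (f w).
  rewrite /f; have [/set_mem//|/negP] := boolP (w \in N1).
  by rewrite inE => /contrapT.
have mf : measurable_fun [set: Omega] (f : Omega -> borel X).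
  exact: (complete_measurable_fun (Y := borel X) (f := f) mu_complete mN1 muN1 ff0 mf0).
have gfE i w : g i (w, f w) = gA i (w, f w) by rewrite gAE patchE mem_set.
have mgf i : measurable_fun [set: Omega] (fun w => g i (w, f w)).
  rewrite (_ : (fun w => _) = gA i \o (fun w => (w, f w))); last exact/funext.
  exact: measurableT_comp (mid _ mf).
pose u i b w := q (Some (i, b)) (w, f0 w).
have mu_ i b : measurable_fun [set: Omega] (u i b).
  exact: measurableT_comp (mid _ mf0).
have iu i b : mu.-integrable [set: Omega] (EFin \o u i b).
  apply/integrableP; split; first exact/measurable_EFinP.
  apply: le_lt_trans (iq (Some (i, b))); rewrite -(f0P _ _ (subG_setT G_sub)).
  apply: ge0_le_integral => //.
  - by apply: measurableT_comp => //; exact/measurable_EFinP.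
  - by apply/measurable_EFinP; exact: mu_.
  - by move=> w _; rewrite /= ger0_norm; [exact: lexx|exact: q0].
(* Off this null set the payoffs are not cut off and [f] agrees with [f0], so differences of payoffs
   recover [g]. *)
pose N2 := ~` F `|` N1.
have mN2 : measurable N2 by apply: measurableU => //; exact: measurableC.
have muN2 : mu N2 = 0%E.
  have muF : mu (~` F) = 0%E by apply: measure_negligible => //; exact: measurableC.
  by apply: null_set_setU => //; exact: measurableC.
have uE i w : ~ N2 w -> u i true w - u i false w = g i (w, f w).
  move=> nN2; rewrite gfE ff0; last by move=> ?; apply: nN2; right.
  have Fw : F w by apply: contrapT => nF; apply: nN2; left.
  by rewrite /u/= indicE mem_set//= !mulr1 posneg.
have igf i : mu.-integrable [set: Omega] (EFin \o (fun w => g i (w, f w))).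
  have iuu : mu.-integrable [set: Omega] ((EFin \o u i true) \- (EFin \o u i false))%E.
    exact: integrableB.
  apply/integrableP; split; first exact/measurable_EFinP.
  have /integrableP[muu] := iuu; apply: le_lt_trans.
  rewrite le_eqVlt; apply/orP; left; apply/eqP; apply: ge0_ae_eq_integral => //.
  - by apply: measurableT_comp => //; exact/measurable_EFinP.
  - exact: measurableT_comp.
  - exists N2; split => // w /=; apply: contra_notP => nN2 _.
    by rewrite /= -(uE _ _ nN2).
have fintE i w : ~ N2 w -> \int[phi w]_(x in A w) g i (w, x) =
    fiber_integral k (q (Some (i, true))) w - fiber_integral k (q (Some (i, false))) w.
  move=> nN2; have Fw : F w by apply: contrapT => nF; apply: nN2; left.
  rewrite /fiber_integral -RintegralB//; last 2 first.
  - by case: (gq (Some (i, true))).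
  - by case: (gq (Some (i, false))).
  rewrite Rintegral_mkcond; apply: eq_Rintegral => x _.
  by rewrite -gAE /= indicE mem_set//= !mulr1 posneg.
exists f; split => //.
apply: aeW => w; apply/rowP => i; rewrite !mxE; congr (_ w); apply: eq_cond_exp => B GB.
have mB := subG_measurable G_sub GB.
pose t b w := fiber_integral k (q (Some (i, b))) w.
have mt b : measurable_fun [set: Omega] (t b) by exact: measurable_fiber_integral.
have it b : mu.-integrable [set: Omega] (EFin \o t b).
  apply/integrableP; split; first exact/measurable_EFinP.
  apply: le_lt_trans (iq (Some (i, b))).
  apply: ge0_le_integral => //.
  - by apply: measurableT_comp => //; exact/measurable_EFinP.
  - by apply/measurable_EFinP; exact: mt.
  - by move=> w' _; rewrite /= ger0_norm; [exact: lexx|exact: fiber_integral_ge0].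
(* Both integrals are written, up to a null set, with positive and negative parts; purification then
   matches the parts one by one. *)
transitivity (\int[mu]_(w in B) (t true w - t false w)%:E)%E.
  apply: ae_eq_integral => //.
  - apply/measurable_EFinP; apply: measurable_funTS.
    (* The integral of [g i] under [phi w] is identified with a measurable function only off [N2];
       completeness gives its measurability. *)
    apply: (complete_measurable_fun (f0 := t true \- t false) mu_complete mN2 muN2).
      by move=> w' nN2; rewrite mxE fintE.
    exact: measurable_funB.
  - by apply/measurable_EFinP; apply: measurable_funTS; exact: measurable_funB.
  - exists N2; split => // w' /=; apply: contra_notP => nN2 _.
    by rewrite mxE fintE.
transitivity (\int[mu]_(w in B) (u i true w - u i false w)%:E)%E.
  under eq_integral do rewrite EFinB.
  under [RHS]eq_integral do rewrite EFinB.
  rewrite !integralB_EFin//; try exact: integrableS (it _);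
    try exact: integrableS (iu _ _).
  by rewrite !f0P.
apply: ae_eq_integral => //.
- by apply/measurable_EFinP; apply: measurable_funTS; exact: measurable_funB.
- apply/measurable_EFinP; apply: measurable_funTS.
  by rewrite (_ : (fun w => _) = (fun w => g i (w, f w)))//; apply/funext => w';
    rewrite mxE.
- exists N2; split => // w' /=; apply: contra_notP => nN2 _.
  by rewrite mxE uE.
Qed.
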